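(* Let $\ell\ge 1$, let $q_1,\dots,q_\ell>2$ be pairwise co-prime natural numbers and let $k\ge 1$ be an integer. Let $\mathbf{K}\subset\mathbb{C}$ be a number field such that $$\mathbf{K}(\zeta_{\varphi(q_1)\cdots\varphi(q_\ell)})\cap \mathbb{Q}(\zeta_{q_1\cdots q_\ell})^{+}=\mathbb{Q}.$$ Then the numbers in the set $$\{\zeta(2k)\}\cup X_{q_1,2k,e}\cup\cdots\cup X_{q_\ell,2k,e}$$ are linearly independent over $\mathbf{K}(\zeta_{\varphi(q_1)\cdots\varphi(q_\ell)})$.
   Context: For an integer $n\ge1$, $\zeta_n$ denotes a primitive $n$-th root of unity, $\varphi$ is Euler's totient function, and for $n>2$, $\mathbb{Q}(\zeta_n)^+=\mathbb{Q}(\zeta_n)\cap\mathbb{R}$ is the maximal real subfield of the $n$-th cyclotomic field. $\zeta(s)$ is the Riemann zeta function. For a Dirichlet character $\chi$ modulo $q$ and $\Re(s)>1$, $L(s,\chi)=\sum_{n\ge1}\chi(n)n^{-s}$. For integers $q>2$, $m\ge 1$, $X_{q,m,e}=\{L(m,\chi) : \chi \bmod q,\ \chi(-1)=1,\ \chi\neq\chi_0\}$, where $\chi_0$ is the trivial (principal) character modulo $q$; i.e. the values at $m$ of the $L$-functions of the non-trivial even Dirichlet characters modulo $q$. *)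

(* Defs.v *)
From Stdlib Require Import Reals ZArith Arith List.
From Coquelicot Require Import Coquelicot.
Import ListNotations.
Open Scope C_scope.

Definition totient (n : nat) : nat :=
  length (filter (fun k => Nat.eqb (Nat.gcd k n) 1%nat) (seq 1 n)).

Definition nprod (l : nat) (f : nat -> nat) : nat :=
  fold_right Nat.mul 1%nat (map f (seq 0 l)).

Definition Cseries (a : nat -> C) : C :=
  (Series (fun n => Re (a n)), Series (fun n => Im (a n))).

Definition zeta_at (s : nat) : C :=
  Cseries (fun n => / RtoC (INR (S n) ^ s)).

Definition is_dirichlet_char (q : nat) (chi : Z -> C) : Prop :=
  (forall n, chi (n + Z.of_nat q)%Z = chi n) /\
  (forall m n, chi (m * n)%Z = chi m * chi n) /\
  chi 1%Z = 1 /\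
  (forall n, chi n = 0 <-> Z.gcd n (Z.of_nat q) <> 1%Z).

Definition principal_char (q : nat) (n : Z) : C :=
  if Z.eqb (Z.gcd n (Z.of_nat q)) 1 then 1 else 0.

Definition Lval (m : nat) (chi : Z -> C) : C :=
  Cseries (fun n => chi (Z.of_nat (S n)) / RtoC (INR (S n) ^ m)).

Definition X_even (q m : nat) (z : C) : Prop :=
  exists chi : Z -> C, is_dirichlet_char q chi /\ chi (-1)%Z = 1 /\
    chi <> principal_char q /\ z = Lval m chi.

Definition is_rat_C (z : C) : Prop :=
  exists (a : Z) (b : positive), z = RtoC (IZR a / IZR (Zpos b)).

Definition is_subfield (F : C -> Prop) : Prop :=
  F 0 /\ F 1 /\ (forall x y, F x -> F y -> F (x + y)) /\
  (forall x, F x -> F (- x)) /\ (forall x y, F x -> F y -> F (x * y)) /\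
  (forall x, F x -> x <> 0 -> F (/ x)).

Definition is_number_field (K : C -> Prop) : Prop :=
  is_subfield K /\
  exists basis : list C, forall x, K x ->
    exists coeffs : list C, List.Forall is_rat_C coeffs /\
      length coeffs = length basis /\
      x = fold_right Cplus 0 (map (fun p : C * C => Cmult (fst p) (snd p)) (combine coeffs basis)).

Definition adjoin (K : C -> Prop) (a : C) : C -> Prop :=
  fun z => forall F, is_subfield F -> (forall x, K x -> F x) -> F a -> F z.

Definition zeta_root (n : nat) : C :=
  (cos (2 * PI / INR n), sin (2 * PI / INR n)).

Definition cyclo_plus (n : nat) : C -> Prop :=
  fun z => adjoin is_rat_C (zeta_root n) z /\ Im z = 0%R.

Definition lin_indep_over (F S : C -> Prop) : Prop :=
  forall l : list (C * C),
    NoDup (map snd l) ->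
    List.Forall (fun p : C * C => F (fst p) /\ S (snd p)) l ->
    fold_right Cplus 0 (map (fun p : C * C => Cmult (fst p) (snd p)) l) = 0 ->
    List.Forall (fun p : C * C => fst p = RtoC 0) l.

(* Main.v *)
(** Let [F] be the field [K(zeta_m)], [m] the product of the [totient (q i)],
    let [N] be the product of the [q i], and [theta b = 2 cos (2 pi b / N)].

    The values are simultaneous eigenvectors of a Galois action.  The series
    [sum_n 1/(n+x)^(2k)] over all integers [n] equals [pi^(2k) P(1/sin^2(pi x))]
    for a rational polynomial [P]: with [P] an eigenvector of the halving
    operator, both sides satisfy the same functional equation under
    [x -> x/2, (x+1)/2], and Herglotz's trick identifies them.  Hence
    [L(2k,chi) = pi^(2k) p(theta 1)] with [p] in [F[X]], and for [b] prime to [N]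
    one has [pi^(2k) p(theta b) = chi(b)^-1 L(2k,chi)]; likewise [zeta(2k)] is
    [pi^(2k)] times a rational number.

    As [F] meets the real cyclotomic field in the rationals, the minimal
    polynomial of [theta 1] over [F] is rational, so by irreducibility of the
    cyclotomic polynomial every polynomial over [F] vanishing at [theta 1]
    vanishes at [theta b].  A linear relation over [F] is thus preserved when each
    [L(2k,chi)] is multiplied by [chi(b)^-1].  The moduli being coprime, the
    characters are pairwise distinct on the units modulo [N], and Dedekind's
    argument kills the relation since [L(2k,chi)] is nonzero. *)

Require Import Defs.
From Stdlib Require Import Reals ZArith Arith List Lia Lra Qreals Znumtheory.
From Stdlib Require Import Classical FunctionalExtensionality IndefiniteDescription.
From Coquelicot Require Import Coquelicot.
From mathcomp Require all_boot all_order all_algebra all_field.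
From mathcomp Require complex Rstruct ring.
Import ListNotations.

(** * Conjugates of [z + 1/z] over a field meeting the cyclotomic field in Q *)

(** No Galois group is formed. An element of $F[\theta_1]$ is carried as a list of coefficients in
    $F$, and its $b$-th conjugate is the value of the same list at [theta N b]. Hence each value
    must be written as an actual polynomial, the same for every $b$. The obstacle is that
    $1/\sin^2(\pi c/N) = 4/(2-\theta_c)$ is a quotient; a finite Fourier expansion turns it into a
    rational combination of the $\theta_{jc}$. Adjoining the root of unity to $K$ makes every
    $\chi(a)$ an admissible coefficient. The eigenvalue $\chi(b)^{-1}$ comes from reindexing $a
    \mapsto ab$ in a sum over residues. All values in the relation carry the same factor $\pi^{2k}$,
    which therefore comes out of it. The polynomial $P$ exists because halving acts triangularly on
    polynomials of degree at most $k$ in $u = 1/\sin^2$, with diagonal entries $2$ for $1$ and $4^d$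
    for $u^d$; the top one, $4^k = 2^{2k}$, occurs once, and it is the factor in the functional
    equation of the series. *)

Module Algebraic.
Import all_boot all_order all_algebra all_field ring.
Set Implicit Arguments.
Unset Strict Implicit.
Unset Printing Implicit Defensive.
Import Order.TTheory GRing.Theory Num.Theory.
Local Open Scope ring_scope.

Lemma dvdp_root (K : fieldType) (p q : {poly K}) x :
  p %| q -> root p x -> root q x.
Proof. by rewrite -!dvdp_XsubCl => pq px; apply: dvdp_trans pq. Qed.

(** * Irreducibility of the cyclotomic polynomials over the rationals *)

Section CyclotomicConjugates.
Variable L : numClosedFieldType.
Implicit Types (p : {poly rat}) (z : L).

(** As $X^n - 1$ is the product of the $\Phi_d$ with $d \mid n$, some $\Phi_d$ vanishes at $z$; then
    $z^d = 1$ and primitivity give $n \mid d$. *)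
Lemma root_Cyclotomic n z :
  n.-primitive_root z -> root (map_poly intr 'Phi_n) z.
Proof.
move=> prz; have n0 := prim_order_gt0 prz.
have : root (map_poly intr ('X^n - 1 : {poly int})) z.
  by rewrite rmorphB rmorph1 /= map_polyXn rootE !hornerE (prim_expr_order prz) subrr.
rewrite -prod_Cyclotomic // rmorph_prod rootE horner_prod prodf_seq_eq0 => /hasP[d].
rewrite -dvdn_divisors // => dn /= rd; rewrite -rootE in rd.
have d0 : (0 < d)%N by apply: dvdn_gt0 dn.
suff <- : d = n by [].
apply/eqP; rewrite eqn_dvd dn /= (prim_order_dvd prz).
have : root (map_poly intr ('X^d - 1 : {poly int})) z.
  rewrite -prod_Cyclotomic // (big_rem d) /=; last by rewrite -dvdn_divisors.
  by rewrite rmorphM rootM rd.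
by rewrite rmorphB rmorph1 /= map_polyXn rootE !hornerE subr_eq0.
Qed.

Lemma map_ratr_intr (K : numFieldType) (q : {poly int}) :
  map_poly (ratr : rat -> K) (map_poly intr q) = map_poly intr q.
Proof. by rewrite -map_poly_comp; apply: eq_map_poly => b; rewrite /= rmorph_int. Qed.

(** The gcd of $\Phi_n$ and $p$ is rational and nonconstant, since $z$ is a common root. Being
    rational, it also has a root $w$ in [algC], again a primitive $n$-th root of unity, and there
    $\Phi_n$ is the minimal polynomial of $w$. So $\Phi_n$ divides the gcd. *)
Lemma Cyclotomic_dvdp n p z : n.-primitive_root z ->
  root (map_poly ratr p) z -> map_poly intr 'Phi_n %| p.
Proof.
move=> prz rz; have n0 := prim_order_gt0 prz.
set P := map_poly intr _.
pose g := gcdp P p.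
have gP : g %| P by exact: dvdp_gcdl.
have P0 : P != 0.
  by rewrite monic_neq0 // /P monic_map // Cyclotomic_monic.
have g0 : g != 0 by rewrite gcdp_eq0 negb_and P0.
have sg : size g != 1%N.
  apply/negP => /eqP sg1.
  have : root (map_poly (ratr : rat -> L) g) z.
    rewrite gcdp_map root_gcd rz andbT /P map_ratr_intr.
    exact: root_Cyclotomic.
  have /size_poly1P[c c0 ->] : size g == 1%N by rewrite sg1.
  by rewrite map_polyC rootC fmorph_eq0 (negbTE c0).
have [|w rw] := @closed_rootP algC (map_poly ratr g) _.
  by rewrite size_map_poly.
have [zC prC] := C_prim_root_exists n0.
have prw : n.-primitive_root w.
  rewrite -(root_cyclotomic prC) -(Cintr_Cyclotomic prC) -map_ratr_intr.
  by apply: dvdp_root rw; rewrite dvdp_map.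
have [P' [eP' _] dvP'] := minCpolyP w.
have -> : P = P'.
  apply: (map_inj_poly (fmorph_inj (ratr : rat -> algC))); rewrite ?rmorph0 //.
  rewrite -eP' (minCpoly_cyclotomic prw) -(Cintr_Cyclotomic prw).
  exact: map_ratr_intr.
apply: (@dvdp_trans _ g); last exact: dvdp_gcdr.
by rewrite -dvP'.
Qed.

Lemma root_rat_conj n b p z : n.-primitive_root z -> coprime b n ->
  root (map_poly ratr p) z -> root (map_poly ratr p) (z ^+ b).
Proof.
move=> prz cb /(Cyclotomic_dvdp prz) dv.
have : root (map_poly ratr (map_poly intr 'Phi_n)) (z ^+ b).
  rewrite map_ratr_intr; apply: root_Cyclotomic.
  by rewrite prim_root_exp_coprime.
by apply: dvdp_root; rewrite dvdp_map.
Qed.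

End CyclotomicConjugates.

(** * Minimal polynomials over a subfield, and the conjugates of $z + 1/z$ *)

Section RealConjugates.
Variable L : numClosedFieldType.

Definition subring (P : L -> Prop) :=
  [/\ P 0, P 1, forall x y, P x -> P y -> P (x - y)
    & forall x y, P x -> P y -> P (x * y)].

Definition coefs_in (P : L -> Prop) (p : {poly L}) := forall i, P p`_i.

Section Coefs.
Variable P : L -> Prop.
Hypothesis Pring : subring P.

Lemma subringN x : P x -> P (- x).
Proof. by case: Pring => P0 _ PB _ Px; rewrite -[- x]add0r; apply: PB. Qed.

Lemma subringD x y : P x -> P y -> P (x + y).
Proof.
case: (Pring) => _ _ PB _ Px Py.
by rewrite -[y]opprK; apply: PB => //; apply: subringN.
Qed.

Lemma coefs_inB p r : coefs_in P p -> coefs_in P r -> coefs_in P (p - r).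
Proof. by case: Pring => _ _ PB _ hp hr i; rewrite coefB; apply: PB. Qed.

Lemma coefs_inM p r : coefs_in P p -> coefs_in P r -> coefs_in P (p * r).
Proof.
case: (Pring) => P0 _ _ PM hp hr i; rewrite coefM.
by apply: big_ind => [//||j _]; [exact: subringD|apply: PM].
Qed.

Lemma coefs_inC c : P c -> coefs_in P c%:P.
Proof. by case: Pring => P0 _ _ _ Pc i; rewrite coefC; case: ifP. Qed.

Lemma coefs_inXn n : coefs_in P 'X^n.
Proof. by case: Pring => P0 P1 _ _ i; rewrite coefXn; case: (_ == _). Qed.

Lemma coefs_in_prod (s : seq L) : (forall x, x \in s -> P x) ->
  coefs_in P (\prod_(x <- s) ('X - x%:P)).
Proof.
elim: s => [|x s IH] h.
  by rewrite big_nil; apply: coefs_inC; case: Pring.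
rewrite big_cons; apply: coefs_inM.
  by apply: coefs_inB (coefs_inXn 1) (coefs_inC _); apply: h; rewrite inE eqxx.
by apply: IH => y ys; apply: h; rewrite inE ys orbT.
Qed.

Lemma subring_nat n : P n%:R.
Proof.
case: (Pring) => P0 P1 _ _; elim: n => [//|n IH].
by rewrite -addn1 natrD; apply: subringD.
Qed.

Lemma subring_int (m : int) : P m%:~R.
Proof.
case: m => n; first exact: subring_nat.
by rewrite NegzE rmorphN; apply: subringN; apply: subring_nat.
Qed.

Lemma subring_rat (r : rat) : (forall x, P x -> P x^-1) -> P (ratr r).
Proof.
case: (Pring) => _ _ _ PM PV.
by rewrite /ratr; apply: PM; [|apply: PV]; apply: subring_int.
Qed.

End Coefs.

(** A nonzero polynomial of least size over [P] vanishing at [x], made monic. Divisibility is long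
    division one leading term at a time, so that every remainder visibly keeps its coefficients in
    the mere predicate [P]. *)
Lemma minimal_poly (P : L -> Prop) (x : L) (p0 : {poly L}) :
  subring P -> (forall y, P y -> P y^-1) ->
  p0 != 0 -> coefs_in P p0 -> root p0 x ->
  exists m : {poly L}, [/\ m \is monic, coefs_in P m, root m x
     & forall p, coefs_in P p -> root p x -> m %| p].
Proof.
move=> Pr PV; case: (Pr) => P0 P1 PB PM.
have [n sn] := ubnP (size p0).
elim: n p0 sn => // n IH p0; rewrite ltnS => sn nz hp rp.
(* Classical descent on the size: either a smaller candidate exists, or [p0] is already minimal. *)
have [[p1 [nz1 sz1 hp1 rp1]]|hmin] := classic (exists p1 : {poly L},
   [/\ p1 != 0, (size p1 < size p0)%N, coefs_in P p1 & root p1 x]).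
  by apply: (IH p1) => //; apply: leq_trans sz1 sn.
pose m := (lead_coef p0)^-1 *: p0.
have lc0 : lead_coef p0 != 0 by rewrite lead_coef_eq0.
have mm : m \is monic by rewrite monicE lead_coefZ mulVf.
have szm : size m = size p0 by rewrite size_scale // invr_eq0.
have hm : coefs_in P m.
  by move=> i; rewrite coefZ; apply: PM; [apply: PV; exact: hp|exact: hp].
have rm : root m x by rewrite /m rootZ // invr_eq0.
exists m; split => // p.
have [k sk] := ubnP (size p).
elim: k p sk => // k IHk p; rewrite ltnS => sk hq rq.
have [->|nzp] := eqVneq p 0; first exact: dvdp0.
have [lt|le] := ltnP (size p) (size p0).
  by case: hmin; exists p.
pose d := (size p - size m)%N.
pose c := lead_coef p.
have szp : (0 < size p)%N by rewrite lt0n size_poly_eq0.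
have szm0 : (0 < size m)%N by rewrite lt0n size_poly_eq0 monic_neq0.
have lem : (size m <= size p)%N by rewrite szm.
have hr : coefs_in P (c%:P * 'X^d * m).
  apply: coefs_inM => //; apply: coefs_inM => //; last exact: coefs_inXn.
  by apply: coefs_inC => //; apply: hq.
(* As [m] is monic, the subtraction cancels the leading term of [p], and the remainder is
   smaller. *)
have dv : m %| (p - c%:P * 'X^d * m).
  apply: IHk.
  - apply: leq_trans sk; rewrite -(prednK szp) ltnS.
    apply/leq_sizeP => j hj; rewrite coefB -mulrA coefCM coefXnM.
    have hdj : (j < d)%N = false.
      apply/negbTE; rewrite -leqNgt; apply: leq_trans hj.
      rewrite -ltnS (prednK szp) /d ltn_subLR //.
      by rewrite -{1}[size p]add0n ltn_add2r.
    rewrite hdj; have [->|ne] := eqVneq j (size p).-1.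
      have -> : ((size p).-1 - d = (size m).-1)%N.
        rewrite /d -subn1 subnAC subKn // subn1 //.
      by rewrite -!lead_coefE (monicP mm) mulr1 subrr.
    have hj' : (size p <= j)%N by rewrite -(prednK szp) ltn_neqAle eq_sym ne.
    rewrite (nth_default _ hj') nth_default ?mulr0 ?subr0 //.
    by rewrite leq_subRL ?subnK // /d (leq_trans (leq_subr _ _)).
  - exact: coefs_inB.
  - by rewrite rootE hornerD hornerN hornerM (rootP rq) (rootP rm) mulr0 subr0.
by move: dv; rewrite dvdp_subl // dvdp_mull.
Qed.

(** The rescaled Chebyshev polynomials $C_n = 2T_n(X/2)$, characterised by $C_n(z + 1/z) = z^n +
    z^{-n}$. *)
Fixpoint chebyshev (n : nat) : {poly rat} :=
  match n with
  | 0%N => 2%:P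
  | n'.+1 => match n' with
            | 0%N => 'X
            | n''.+1 => 'X * chebyshev n' - chebyshev n''
            end
  end.

Lemma chebyshevE n (z : L) : z != 0 ->
  (map_poly ratr (chebyshev n)).[z + z^-1] = z ^+ n + z ^- n.
Proof.
move=> z0; elim/ltn_ind: n => -[|[|n]] IH.
- by rewrite /= map_polyC /= hornerC expr0 invr1 rmorph_nat.
- by rewrite /= map_polyX hornerX expr1.
rewrite [chebyshev _]/= rmorphB rmorphM /= map_polyX !hornerE.
rewrite -/(chebyshev n.+1) !IH //.
rewrite !exprS; field.
by rewrite z0 expf_neq0.
Qed.

(** Over a closed field every $w$ is $y + 1/y$, with $y$ a root of $X^2 - wX + 1$. Then $C_n(w) = 2$
    reads $(y^n - 1)^2 = 0$, so $y$ is a power of $z$. *)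
Lemma root_chebyshev n z (w : L) : n.-primitive_root z ->
  root (map_poly ratr (chebyshev n - 2%:P)) w ->
  exists c : nat, w = z ^+ c + z ^- c.
Proof.
move=> prz.
have [|y ry] := @closed_rootP L ('X^2 - w *: 'X + 1) _.
  by rewrite -addrA size_polyDl ?size_polyXn // (leq_ltn_trans (size_polyD _ _)) // gtn_max size_polyN size_poly1 (leq_ltn_trans (size_scale_leq _ _)) ?size_polyX.
have ry' : y ^+ 2 - w * y + 1 = 0 by move/rootP: ry; rewrite !hornerE.
have y0 : y != 0.
  by apply/eqP => y0; move: ry'; rewrite y0 expr0n mulr0 subr0 add0r => /eqP; rewrite oner_eq0.
have -> : w = y + y^-1.
  apply: (mulIf y0); rewrite mulrDl mulVf // -expr2.
  by apply/eqP; rewrite eq_sym -subr_eq0 addrAC ry'.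
rewrite rmorphB /= map_polyC /= rootE !hornerE chebyshevE // rmorph_nat subr_eq0.
move=> /eqP e.
have yn0 : y ^+ n != 0 by rewrite expf_neq0.
have : (y ^+ n - 1) ^+ 2 == 0.
  have -> : (y ^+ n - 1) ^+ 2 = (y ^+ n + y ^- n - 2) * y ^+ n by field.
  by rewrite e subrr mul0r.
rewrite sqrf_eq0 subr_eq0 => /eqP yn1.
by have [c ->] := prim_rootP prz yn1; exists c.
Qed.

(* If [P] meets the real cyclotomic ring only in the rationals, the minimal
   polynomial of [z + z^-1] over [P] has rational coefficients: its roots are
   conjugates [z^c + z^-c], so its coefficients are in [E] as well. *)
Lemma real_conjugate_root (P E : L -> Prop) n b (z : L) (p : {poly L}) :
  subring P -> (forall x, P x -> P x^-1) -> subring E ->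
  n.-primitive_root z -> (forall c, E (z ^+ c + z ^- c)) ->
  (forall x, P x -> E x -> exists r : rat, x = ratr r) ->
  coprime b n -> coefs_in P p -> root p (z + z^-1) ->
  root p (z ^+ b + z ^- b).
Proof.
move=> Pr PV Er prz Ez PE cb hp rp.
have n0 := prim_order_gt0 prz.
have z0 : z != 0 by rewrite (prim_root_eq0 prz) -lt0n.
have hT : coefs_in P (map_poly ratr (chebyshev n - 2%:P)).
  by move=> i; rewrite coef_map /=; apply: subring_rat.
(* Nonzero because its value at $2 + 1/2$ is $(2^n - 1)^2/2^n$. *)
have T0 : map_poly (ratr : rat -> L) (chebyshev n - 2%:P) != 0.
  apply/negP => /eqP /(congr1 (fun q : {poly L} => q.[2 + 2^-1])) /eqP.
  rewrite rmorphB /= map_polyC /= !hornerE chebyshevE ?pnatr_eq0 // rmorph_nat.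
  have t0 : (2 : L) ^+ n != 0 by rewrite expf_neq0 ?pnatr_eq0.
  have -> : (2 : L) ^+ n + 2 ^- n - 2 = (2 ^+ n - 1) ^+ 2 / 2 ^+ n by field.
  rewrite mulf_eq0 invr_eq0 (negbTE t0) orbF sqrf_eq0 subr_eq0 -natrX.
  by rewrite (eqr_nat L _ 1) -(expn0 2) eqn_exp2l // (gtn_eqF n0).
have rT : root (map_poly ratr (chebyshev n - 2%:P)) (z + z^-1).
  rewrite rmorphB /= map_polyC /= rootE !hornerE chebyshevE // rmorph_nat.
  by rewrite (prim_expr_order prz) invr1 subrr.
have [m [mm hm rm dvm]] := minimal_poly Pr PV T0 hT rT.
have hE : coefs_in E m.
  have [rs Dm] := closed_field_poly_normal m.
  rewrite Dm (monicP mm) scale1r; apply: coefs_in_prod => // w wr.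
  have rw : root m w by rewrite Dm (monicP mm) scale1r root_prod_XsubC.
  have [c ->] := root_chebyshev prz (dvdp_root (dvm _ hT rT) rw).
  exact: Ez.
have [f hf] : exists f : nat -> rat, forall i, m`_i = ratr (f i).
  have h i : {r : rat | m`_i == ratr r}.
    by apply: sigW; have [r ->] := PE _ (hm i) (hE i); exists r.
  by exists (fun i => sval (h i)) => i; apply/eqP; case: (h i).
(* [M] is $y^{s} m(y + 1/y)$ with $s$ the size of [m]. Clearing denominators gives a rational
   polynomial in $z$ itself, to which irreducibility of $\Phi_n$ applies. *)
pose M : {poly rat} := \sum_(i < size m) (f i)%:P * ('X^2 + 1) ^+ i * 'X^(size m - i).
have ME y : y != 0 -> (map_poly ratr M).[y] = y ^+ size m * m.[y + y^-1].
  move=> y0; rewrite rmorph_sum /= horner_sum horner_coef mulr_sumr.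
  apply: eq_bigr => i _.
  rewrite !rmorphM rmorphXn rmorphD rmorph1 /= !map_polyXn map_polyC /= !hornerE -hf.
  have -> : y ^+ size m = y ^+ i * y ^+ (size m - i) by rewrite -exprD subnKC // ltnW.
  have -> : y ^+ 2 + 1 = y * (y + y^-1) by field.
  rewrite exprMn; move: (y ^+ i) ((y + y^-1) ^+ i) (y ^+ (size m - i)) m`_i => ? ? ? ?.
  rewrite /=; ring.
have rM : root (map_poly ratr M) z by rewrite rootE ME // (rootP rm) mulr0.
have := root_rat_conj prz cb rM.
rewrite rootE ME ?expf_neq0 // mulf_eq0 expf_eq0 expf_eq0 (negbTE z0) !andbF /= => rmb.
by apply: dvdp_root (dvm _ hp rp) _.
Qed.

End RealConjugates.
End Algebraic.

(** * The series sum 1/(n+x)^(2k) as a rational polynomial in 1/sin^2 *)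

Open Scope R_scope.

Fixpoint Rsum (f : nat -> R) (n : nat) : R :=
  match n with O => 0 | S m => Rsum f m + f m end.

Lemma Rsum_ext f g n :
  (forall i, (i < n)%nat -> f i = g i) -> Rsum f n = Rsum g n.
Proof.
  induction n as [|n IH]; intros H; simpl; [reflexivity|].
  rewrite IH by (intros; apply H; lia). rewrite H by lia. reflexivity.
Qed.

Lemma Rsum_plus f g n : Rsum (fun i => f i + g i) n = Rsum f n + Rsum g n.
Proof. induction n as [|n IH]; simpl; [ring|]. rewrite IH; ring. Qed.

Lemma Rsum_scal c f n : Rsum (fun i => c * f i) n = c * Rsum f n.
Proof. induction n as [|n IH]; simpl; [ring|]. rewrite IH; ring. Qed.

Lemma Rsum_app f n m :
  Rsum f (n + m) = Rsum f n + Rsum (fun i => f (n + i)%nat) m.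
Proof.
  induction m as [|m IH]; simpl.
  - rewrite Nat.add_0_r; ring.
  - rewrite Nat.add_succ_r; simpl. rewrite IH; ring.
Qed.

Lemma Rsum_blocks a q n :
  Rsum a (n * q) = Rsum (fun r => Rsum (fun m => a (m * q + r)%nat) n) q.
Proof.
  induction n as [|n IH]; simpl.
  - induction q as [|q IHq]; simpl; [reflexivity|].
    simpl in IHq. rewrite <- IHq. ring.
  - rewrite Nat.add_comm, Rsum_app, IH, <- Rsum_plus. reflexivity.
Qed.

Lemma sum_n_Rsum a n : sum_n a n = Rsum a (S n).
Proof.
  induction n as [|n IH].
  - rewrite sum_O. symmetry. apply Rplus_0_l.
  - rewrite sum_Sn, IH. reflexivity.
Qed.

Lemma is_series_Rsum a l : is_series a l <-> is_lim_seq (Rsum a) l.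
Proof.
  assert (E : is_series a l <-> is_lim_seq (fun n => Rsum a (S n)) l).
  { split; intros H.
    - apply is_lim_seq_ext with (sum_n a); [apply sum_n_Rsum|exact H].
    - apply is_lim_seq_ext with (v := sum_n a) in H; [exact H|].
      intros n; symmetry; apply sum_n_Rsum. }
  rewrite E. symmetry. apply is_lim_seq_incr_1.
Qed.

Lemma Series_zero : Series (fun _ => 0) = 0.
Proof.
  apply is_series_unique, is_series_Rsum.
  apply is_lim_seq_ext with (fun _ => 0); [|apply is_lim_seq_const].
  induction n as [|n IH]; simpl; lra.
Qed.

Lemma is_lim_seq_Rsum (u : nat -> nat -> R) (f : nat -> R) q :
  (forall r, (r < q)%nat -> is_lim_seq (u r) (f r)) ->
  is_lim_seq (fun n => Rsum (fun r => u r n) q) (Rsum f q).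
Proof.
  induction q as [|q IH]; intros H; simpl.
  - apply is_lim_seq_const.
  - apply is_lim_seq_plus'; [apply IH; intros; apply H; lia|apply H; lia].
Qed.

(** The partial sums of length $nq$ are a subsequence, and each splits into $q$ partial sums along
    residue classes. *)
Lemma Series_blocks a q (f : nat -> R) : (0 < q)%nat -> ex_series a ->
  (forall r, (r < q)%nat -> is_series (fun m => a (m * q + r)%nat) (f r)) ->
  Series a = Rsum f q.
Proof.
  intros Hq Ha Hf.
  apply Series_correct, is_series_Rsum in Ha.
  assert (H1 : is_lim_seq (fun n => Rsum a (n * q)) (Series a)).
  { apply (is_lim_seq_subseq (Rsum a) _ (fun n => (n * q)%nat)); [|exact Ha].
    apply eventually_subseq. intros n. nia. }
  assert (H2 : is_lim_seq (fun n => Rsum a (n * q)) (Rsum f q)).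
  { apply is_lim_seq_ext with
      (fun n => Rsum (fun r => Rsum (fun m => a (m * q + r)%nat) n) q).
    - intros n; symmetry; apply Rsum_blocks.
    - apply (is_lim_seq_Rsum (fun r n => Rsum (fun m => a (m * q + r)%nat) n)).
      intros r Hr. apply is_series_Rsum. apply Hf, Hr. }
  apply is_lim_seq_unique in H1. apply is_lim_seq_unique in H2.
  rewrite H1 in H2. injection H2. auto.
Qed.

Lemma is_series_telescope :
  is_series (fun n => / INR (S n) - / INR (S (S n))) 1.
Proof.
  apply is_series_Rsum.
  apply is_lim_seq_ext with (fun n => 1 - / INR (S n)).
  - induction n as [|n IH]; [simpl; field|].
    cbn [Rsum]. rewrite <- IH. ring.
  - replace (Finite 1) with (Rbar_minus (Finite 1) (Rbar_inv p_infty)).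
    2: simpl; f_equal; ring.
    apply is_lim_seq_minus'; [apply is_lim_seq_const|].
    apply (is_lim_seq_inv (fun n => INR (S n)) p_infty); [|discriminate].
    apply (is_lim_seq_incr_1 INR). apply is_lim_seq_INR.
Qed.

Lemma pow_inv_le (x : R) (s : nat) : 1 <= x -> (2 <= s)%nat -> / x ^ s <= / x ^ 2.
Proof.
  intros Hx Hs. apply Rinv_le_contravar.
  - apply pow_lt; lra.
  - apply Rle_pow; assumption.
Qed.

Lemma ex_series_inv_pow (s : nat) : (2 <= s)%nat ->
  ex_series (fun n => / INR (S n) ^ s).
Proof.
  intros Hs.
  apply (ex_series_le (V := R_CompleteNormedModule) _
    (fun n => 2 * (/ INR (S n) - / INR (S (S n))))).
  - intros n. change (norm (/ INR (S n) ^ s)) with (Rabs (/ INR (S n) ^ s)).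
    assert (H1 : 1 <= INR (S n)) by (rewrite S_INR; generalize (pos_INR n); lra).
    rewrite Rabs_right.
    2: { apply Rle_ge, Rlt_le, Rinv_0_lt_compat, pow_lt; lra. }
    eapply Rle_trans; [apply pow_inv_le; assumption|].
    rewrite (S_INR (S n)). set (y := INR (S n)) in *.
    (* The factor 2 of the telescoping majorant comes from $y + 1 \le 2y$ for $y \ge 1$. *)
    replace (2 * (/ y - / (y + 1))) with (/ (y ^ 2) * (2 * y / (y + 1))) by (field; lra).
    rewrite <- (Rmult_1_r (/ y ^ 2)) at 1.
    apply Rmult_le_compat_l.
    + apply Rlt_le, Rinv_0_lt_compat, pow_lt; lra.
    + apply Rmult_le_reg_r with (y + 1); [lra|]. unfold Rdiv.
      rewrite Rmult_assoc, Rinv_l by lra. lra.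
  - apply (ex_series_scal (V := R_NormedModule) 2
      (fun n => / INR (S n) - / INR (S (S n)))).
    exists 1. apply is_series_telescope.
Qed.

(** * The Hurwitz zeta function $\zeta(s,x)$ at integer $s$, and its symmetrisation *)

Definition hur (s : nat) (x : R) : R := Series (fun m => / (INR m + x) ^ s).

Section Hurwitz.
Variable s : nat.
Hypothesis Hs : (2 <= s)%nat.

Lemma hur_term_pos x m : 0 < x -> 0 < / (INR m + x) ^ s.
Proof.
  intros Hx. apply Rinv_0_lt_compat, pow_lt. generalize (pos_INR m); lra.
Qed.

Lemma ex_series_hur x : 0 < x -> ex_series (fun m => / (INR m + x) ^ s).
Proof.
  intros Hx. apply ex_series_incr_1.
  apply (ex_series_le (V := R_CompleteNormedModule) _ (fun n => / INR (S n) ^ s)).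
  - intros n. change (norm (/ (INR (S n) + x) ^ s)) with (Rabs (/ (INR (S n) + x) ^ s)).
    rewrite Rabs_right by (apply Rle_ge, Rlt_le, hur_term_pos; assumption).
    assert (H1 : 1 <= INR (S n)) by (rewrite S_INR; generalize (pos_INR n); lra).
    apply Rinv_le_contravar; [apply pow_lt; lra|].
    apply pow_incr; lra.
  - apply ex_series_inv_pow, Hs.
Qed.

Lemma is_series_hur_block x q r : (0 < q)%nat -> 0 < x ->
  is_series (fun m => / (INR (m * q + r) + x) ^ s)
    (/ INR q ^ s * hur s ((x + INR r) / INR q)).
Proof.
  intros Hq Hx.
  assert (Hq' : 0 < INR q) by (apply lt_0_INR; lia).
  assert (Hr := pos_INR r).
  assert (H : 0 < (x + INR r) / INR q) by (apply Rdiv_lt_0_compat; lra).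
  apply is_series_ext with
    (fun m => / INR q ^ s * / (INR m + (x + INR r) / INR q) ^ s).
  - intros m. rewrite <- Rinv_mult, <- Rpow_mult_distr. f_equal. f_equal.
    rewrite plus_INR, mult_INR. field. lra.
  - apply (is_series_scal (V := R_NormedModule) (/ INR q ^ s)
      (fun m => / (INR m + (x + INR r) / INR q) ^ s)).
    apply Series_correct, ex_series_hur, H.
Qed.

Lemma hur_blocks x q : (0 < q)%nat -> 0 < x ->
  hur s x = Rsum (fun r => / INR q ^ s * hur s ((x + INR r) / INR q)) q.
Proof.
  intros Hq Hx. apply Series_blocks; [exact Hq|apply ex_series_hur, Hx|].
  intros r _. apply (is_series_hur_block x q r Hq Hx).
Qed.

Lemma hur_double x : 0 < x ->
  hur s (x / 2) + hur s ((x + 1) / 2) = 2 ^ s * hur s x.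
Proof.
  intros Hx. rewrite (hur_blocks x 2) by (lia || assumption).
  simpl. replace (1 + 1) with 2 by ring.
  rewrite Rplus_0_r. field. apply pow_nonzero; lra.
Qed.

Lemma hur_step x : 0 < x -> hur s x = / x ^ s + hur s (1 + x).
Proof.
  intros Hx. unfold hur. rewrite Series_incr_1 by (apply ex_series_hur, Hx).
  rewrite Rplus_0_l. f_equal. apply Series_ext. intros n.
  rewrite S_INR. f_equal. f_equal. ring.
Qed.

Lemma hur_le x y : 0 < x <= y -> hur s y <= hur s x.
Proof.
  intros Hx. apply Series_le; [|apply ex_series_hur; lra].
  intros n. split; [apply Rlt_le, hur_term_pos; lra|].
  assert (H := pos_INR n).
  apply Rinv_le_contravar; [apply pow_lt; lra|].
  apply pow_incr; lra.
Qed.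

Lemma hur_pos x : 0 < x -> 0 <= hur s x.
Proof.
  intros Hx. unfold hur.
  rewrite <- Series_zero.
  apply Series_le; [|apply ex_series_hur; lra].
  intros n. split; [lra|apply Rlt_le, hur_term_pos; lra].
Qed.

(** For even [s] this is the sum of $1/(n+x)^s$ over all integers $n$: the negative $n = -(m+1)$
    contribute $1/(m+1-x)^s$. *)
Definition hur2 (x : R) : R := hur s x + hur s (1 - x).

Lemma hur2_sym x : hur2 (1 - x) = hur2 x.
Proof. unfold hur2. replace (1 - (1 - x)) with x by ring. ring. Qed.

Lemma hur2_double x : 0 < x < 1 ->
  hur2 (x / 2) + hur2 ((x + 1) / 2) = 2 ^ s * hur2 x.
Proof.
  intros Hx. unfold hur2.
  rewrite Rmult_plus_distr_l, <- !hur_double by lra.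
  replace (1 - x / 2) with ((1 - x + 1) / 2) by field.
  replace (1 - (x + 1) / 2) with ((1 - x) / 2) by field. ring.
Qed.

(** On this half interval only the term $x^{-s}$ is unbounded; the two remaining series are monotone
    in their argument. *)
Lemma hur2_bound x : 0 < x <= 1 / 2 ->
  0 <= hur2 x - / x ^ s <= hur s 1 + hur s (1 / 2).
Proof.
  intros Hx. unfold hur2. rewrite hur_step by lra.
  assert (H1 := hur_le 1 (1 + x) ltac:(lra)).
  assert (H2 := hur_le (1 / 2) (1 - x) ltac:(lra)).
  assert (H3 := hur_pos (1 + x) ltac:(lra)).
  assert (H4 := hur_pos (1 - x) ltac:(lra)).
  lra.
Qed.

End Hurwitz.

(** * Rational polynomials and the halving operator *)

Definition ratR (x : R) : Prop := exists r : Q, x = Q2R r.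

Lemma ratR_plus x y : ratR x -> ratR y -> ratR (x + y).
Proof. intros [r ->] [t ->]. exists (r + t)%Q. symmetry; apply Q2R_plus. Qed.
Lemma ratR_mult x y : ratR x -> ratR y -> ratR (x * y).
Proof. intros [r ->] [t ->]. exists (r * t)%Q. symmetry; apply Q2R_mult. Qed.
Lemma ratR_IZR z : ratR (IZR z).
Proof. exists (inject_Z z). unfold Q2R; simpl. field. Qed.
Lemma ratR_INR n : ratR (INR n).
Proof. rewrite INR_IZR_INZ. apply ratR_IZR. Qed.
Lemma ratR_inv x : ratR x -> ratR (/ x).
Proof.
  intros [r ->]. destruct (Qeq_dec r 0) as [E|E].
  - exists 0%Q. apply Qeq_eqR in E. rewrite E, RMicromega.Q2R_0. apply Rinv_0.
  - exists (/ r)%Q. symmetry; apply Q2R_inv, E.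
Qed.
Lemma ratR_pow x n : ratR x -> ratR (x ^ n).
Proof.
  intros H; induction n; simpl; [apply ratR_IZR|apply ratR_mult; assumption].
Qed.
Lemma ratR_is_rat x : ratR x -> is_rat_C (RtoC x).
Proof. intros [r ->]. exists (Qnum r), (Qden r). reflexivity. Qed.

(* [ratpoly d f]: [f] is a polynomial function of degree at most [d] with
   rational coefficients, peeled from the leading coefficient. *)
Inductive ratpoly : nat -> (R -> R) -> Prop :=
| ratpoly_O a f : ratR a -> (forall u, f u = a) -> ratpoly 0 f
| ratpoly_S d a g f : ratR a -> ratpoly d g ->
    (forall u, f u = a * u ^ S d + g u) -> ratpoly (S d) f.

Lemma ratpoly_plus d f g :
  ratpoly d f -> ratpoly d g -> ratpoly d (fun u => f u + g u).
Proof.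
  intros Hf; revert g; induction Hf as [a f Ha E|d a f' f Ha Hf IH E];
    intros g Hg; inversion Hg as [b g1 Hb E' E1 E2|d' b g' g1 Hb Hg' E' E1 E2]; subst.
  - apply (ratpoly_O (a + b)); [apply ratR_plus; assumption|].
    intros; rewrite E, E'; reflexivity.
  - apply (ratpoly_S d (a + b) (fun u => f' u + g' u));
      [apply ratR_plus; assumption|apply IH; assumption|].
    intros; rewrite E, E'; ring.
Qed.

Lemma ratpoly_scal d c f : ratR c -> ratpoly d f -> ratpoly d (fun u => c * f u).
Proof.
  intros Hc Hf; induction Hf as [a f Ha E|d a f' f Ha Hf IH E].
  - apply (ratpoly_O (c * a)); [apply ratR_mult; assumption|].
    intros; rewrite E; reflexivity.
  - apply (ratpoly_S d (c * a) (fun u => c * f' u));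
      [apply ratR_mult; assumption|assumption|].
    intros; rewrite E; ring.
Qed.

Lemma ratpoly_weaken d f : ratpoly d f -> ratpoly (S d) f.
Proof.
  intros H. apply (ratpoly_S d 0 f); [apply ratR_IZR|assumption|]. intros; ring.
Qed.

Lemma ratpoly_mulX d f : ratpoly d f -> ratpoly (S d) (fun u => u * f u).
Proof.
  intros Hf; induction Hf as [a f Ha E|d a f' f Ha Hf IH E].
  - apply (ratpoly_S 0 a (fun _ => 0)); [assumption| |].
    + apply (ratpoly_O 0); [apply ratR_IZR|reflexivity].
    + intros; rewrite E; simpl; ring.
  - apply (ratpoly_S (S d) a (fun u => u * f' u)); [assumption..|].
    intros; rewrite E; simpl; ring.
Qed.

Lemma ratpoly_pow d : ratpoly d (fun u => u ^ d).
Proof.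
  induction d; [apply (ratpoly_O 1); [apply ratR_IZR|reflexivity]|].
  simpl. apply (ratpoly_mulX d (fun u => u ^ d)); assumption.
Qed.

Lemma ratpoly_bound d f : ratpoly d f ->
  exists M, 0 <= M /\ forall u, 1 <= u -> Rabs (f u) <= M * u ^ d.
Proof.
  intros Hf; induction Hf as [a f Ha E|d a f' f Ha Hf [M [HM IH]] E].
  - exists (Rabs a). split; [apply Rabs_pos|]. intros; rewrite E; simpl; lra.
  - exists (Rabs a + M). split; [generalize (Rabs_pos a); lra|].
    intros u Hu. rewrite E.
    eapply Rle_trans; [apply Rabs_triang|].
    rewrite Rabs_mult, (Rabs_right (u ^ S d)) by (apply Rle_ge, pow_le; lra).
    specialize (IH u Hu).
    assert (H : u ^ d <= u ^ S d) by (apply Rle_pow; [lra|lia]).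
    assert (H' : M * u ^ d <= M * u ^ S d) by (apply Rmult_le_compat_l; lra).
    lra.
Qed.

Lemma ratpoly_rat d f x : ratpoly d f -> ratR x -> ratR (f x).
Proof.
  intros Hf Hx; induction Hf as [a f Ha E|d a f' f Ha Hf IH E]; rewrite E;
    [assumption|].
  apply ratR_plus; [apply ratR_mult; [|apply ratR_pow]|]; assumption.
Qed.

(* [u1], [u2] are the values of 1/sin^2 at the two halves of a point where it
   takes the value [u]. *)
Definition halves (u u1 u2 : R) : Prop := u1 + u2 = 4 * u /\ u1 * u2 = 4 * u.

(** Newton's recurrence $p_{n+2} = e_1 p_{n+1} - e_2 p_n$ for power sums, with both elementary
    symmetric functions equal to $4u$. *)
Lemma halves_power_sum m : exists e, ratpoly m e /\
  forall u u1 u2, halves u u1 u2 ->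
    u1 ^ S m + u2 ^ S m = (4 * u) ^ S m + e u.
Proof.
  enough (H : forall n, (n <= m)%nat -> exists e, ratpoly n e /\
     forall u u1 u2, halves u u1 u2 ->
     u1 ^ S n + u2 ^ S n = (4 * u) ^ S n + e u) by (apply (H m); lia).
  induction m as [|m IH]; intros n Hn.
  { replace n with 0%nat by lia. exists (fun _ => 0). split.
    - apply (ratpoly_O 0); [apply ratR_IZR|reflexivity].
    - intros u u1 u2 [H _]. simpl. lra. }
  destruct (Nat.eq_dec n (S m)) as [->|Hne]; [|apply IH; lia].
  destruct m as [|m].
  { exists (fun u => (-8) * u ^ 1). split.
    - apply ratpoly_scal; [apply (ratR_IZR (-8))|apply ratpoly_pow].
    - intros u u1 u2 [H1 H2]. simpl.
      replace (u1 * (u1 * 1) + u2 * (u2 * 1))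
        with ((u1 + u2) * (u1 + u2) - 2 * (u1 * u2)) by ring.
      rewrite H1, H2. ring. }
  destruct (IH (S m)) as [e1 [He1 E1]]; [lia|].
  destruct (IH m) as [e0 [He0 E0]]; [lia|].
  (* The expansion of $4u(p_{m+2} - p_{m+1})$ without its top term $(4u)^{m+3}$. *)
  exists (fun u => 4 * (u * e1 u) + ((- 4 ^ S (S m)) * u ^ S (S m) + (-4) * (u * e0 u))).
  split.
  - apply ratpoly_plus.
    + apply ratpoly_scal; [apply (ratR_IZR 4)|]. apply ratpoly_mulX, He1.
    + apply ratpoly_plus.
      * apply (ratpoly_scal (S (S m)) (- 4 ^ S (S m)) (fun u => u ^ S (S m)));
          [|apply ratpoly_pow].
        replace (- 4 ^ S (S m)) with ((-1) * 4 ^ S (S m)) by ring.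
        apply ratR_mult; [apply (ratR_IZR (-1))|apply ratR_pow, (ratR_IZR 4)].
      * apply ratpoly_scal; [apply (ratR_IZR (-4))|].
        apply ratpoly_weaken, ratpoly_mulX, He0.
  - intros u u1 u2 Hh. destruct Hh as [H1 H2] eqn:Eh.
    replace (u1 ^ S (S (S m)) + u2 ^ S (S (S m)))
      with ((u1 + u2) * (u1 ^ S (S m) + u2 ^ S (S m))
            - (u1 * u2) * (u1 ^ S m + u2 ^ S m)) by (simpl; ring).
    rewrite (E1 u u1 u2 Hh), (E0 u u1 u2 Hh), H1, H2.
    rewrite !Rpow_mult_distr. simpl. ring.
Qed.

(** The operator is triangular in the degree, with diagonal entries $4^k - 2$ in degree 0 and $4^k -
    4^{d}$ in degree $d > 0$. These are nonzero below degree $k$, so the coefficients are solved for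
    from the top; [t] below is the leading one. *)
Lemma halving_solve k d c : (d < k)%nat -> ratpoly d c -> exists r, ratpoly d r /\
  forall u u1 u2, halves u u1 u2 -> 4 ^ k * r u - r u1 - r u2 = c u.
Proof.
  revert c; induction d as [|d IH]; intros c Hd Hc;
    inversion Hc as [b g1 Hb E' E1 E2|d' b g' g1 Hb Hg' E' E1 E2]; subst.
  - assert (H4 : 2 < 4 ^ k).
    { apply Rlt_le_trans with (4 ^ 1); [simpl; lra|apply Rle_pow; [lra|lia]]. }
    exists (fun _ => b * / (4 ^ k + (-2))). split.
    + apply (ratpoly_O (b * / (4 ^ k + (-2)))); [|reflexivity].
      apply ratR_mult; [assumption|]. apply ratR_inv.
      apply ratR_plus; [apply ratR_pow, (ratR_IZR 4)|apply (ratR_IZR (-2))].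
    + intros. rewrite E'. field. lra.
  - assert (H4 : 4 ^ S d < 4 ^ k) by (apply Rlt_pow; [lra|lia]).
    destruct (halves_power_sum d) as [e [He E]].
    set (t := b * / (4 ^ k + (-1) * 4 ^ S d)).
    assert (Ht : ratR t).
    { apply ratR_mult; [assumption|]. apply ratR_inv.
      apply ratR_plus; [apply ratR_pow, (ratR_IZR 4)|].
      apply ratR_mult; [apply (ratR_IZR (-1))|apply ratR_pow, (ratR_IZR 4)]. }
    destruct (IH (fun u => g' u + t * e u)) as [r [Hr Er]]; [lia| |].
    { apply ratpoly_plus; [assumption|]. apply ratpoly_scal; assumption. }
    exists (fun u => t * u ^ S d + r u). split.
    + apply (ratpoly_S d t r); [assumption..|reflexivity].
    + intros u u1 u2 Hh. specialize (E u u1 u2 Hh). specialize (Er u u1 u2 Hh).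
      rewrite E'.
      replace (4 ^ k * (t * u ^ S d + r u) - (t * u1 ^ S d + r u1) - (t * u2 ^ S d + r u2))
        with (4 ^ k * t * u ^ S d - t * (u1 ^ S d + u2 ^ S d)
              + (4 ^ k * r u - r u1 - r u2)) by ring.
      rewrite Er, E, Rpow_mult_distr.
      replace b with (t * (4 ^ k + (-1) * 4 ^ S d)) by (unfold t; field; lra).
      ring.
Qed.

(** The monomial $u^{j+1}$ is an eigenvector up to an error of degree $j$, which the lower-order
    correction [r] absorbs. Keeping [P] monic makes its leading singularity that of the series. *)
Lemma halving_eigenpoly j : exists P r, ratpoly (S j) P /\ ratpoly j r /\
  (forall u, P u = u ^ S j + r u) /\
  forall u u1 u2, halves u u1 u2 -> P u1 + P u2 = 4 ^ S j * P u.
Proof.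
  destruct (halves_power_sum j) as [e [He E]].
  destruct (halving_solve (S j) j e) as [r [Hr Er]]; [lia|assumption|].
  exists (fun u => u ^ S j + r u), r. repeat split.
  - apply ratpoly_plus; [apply ratpoly_pow|apply ratpoly_weaken, Hr].
  - exact Hr.
  - intros u u1 u2 Hh. specialize (E u u1 u2 Hh). specialize (Er u u1 u2 Hh).
    rewrite Rpow_mult_distr in E. lra.
Qed.

(** * The squared cosecant: halving, growth, and identification with the series *)

Definition csc2 (x : R) : R := / (sin (PI * x)) ^ 2.

Lemma sin_PI_pos x : 0 < x < 1 -> 0 < sin (PI * x).
Proof. intros Hx. assert (P := PI_RGT_0). apply sin_gt_0; nra. Qed.

(** With $t = \pi x/2$ the two values are $1/\sin^2 t$ and $1/\cos^2 t$; sum and product both equal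
    $1/(\sin t\cos t)^2 = 4/\sin^2 2t$. *)
Lemma csc2_halves x : 0 < x < 1 ->
  halves (csc2 x) (csc2 (x / 2)) (csc2 ((x + 1) / 2)).
Proof.
  intros Hx. assert (P := PI_RGT_0). unfold csc2.
  replace (PI * ((x + 1) / 2)) with (PI / 2 + PI * (x / 2)) by field.
  rewrite <- cos_sin.
  replace (PI * x) with (2 * (PI * (x / 2))) by field.
  rewrite sin_2a. set (t := PI * (x / 2)).
  assert (Hs : 0 < sin t) by (apply sin_PI_pos; lra).
  assert (Hc : 0 < cos t) by (apply cos_gt_0; unfold t; nra).
  assert (H := sin2_cos2 t). unfold Rsqr in H.
  assert (E : / sin t ^ 2 + / cos t ^ 2 = 4 * / (2 * sin t * cos t) ^ 2).
  { replace (/ sin t ^ 2 + / cos t ^ 2)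
      with ((sin t * sin t + cos t * cos t) * / (sin t ^ 2 * cos t ^ 2)) by (field; lra).
    rewrite H. field. lra. }
  split; [exact E|]. field. lra.
Qed.

Lemma csc2_ge1 x : 0 < x < 1 -> 1 <= csc2 x.
Proof.
  intros Hx. unfold csc2. assert (Hs := sin_PI_pos x Hx).
  assert (Hb := SIN_bound (PI * x)).
  rewrite <- Rinv_1. apply Rinv_le_contravar; [apply pow_lt; lra|]. nra.
Qed.

Lemma csc2_sym x : csc2 (1 - x) = csc2 x.
Proof.
  unfold csc2. replace (PI * (1 - x)) with (PI - PI * x) by ring.
  rewrite sin_PI_x. reflexivity.
Qed.

Lemma x_cos_le_sin t : 0 <= t <= PI / 2 -> t * cos t <= sin t.
Proof.
  intros Ht. assert (P := PI_RGT_0).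
  destruct (Req_dec t 0) as [->|H0]; [rewrite sin_0; lra|].
  destruct (MVT_gen (fun y => sin y - y * cos y) 0 t (fun y => y * sin y))
    as [c [Hc E]].
  - intros y Hy. auto_derive; [exact I|]. ring.
  - intros y Hy. apply continuity_pt_filterlim.
    apply (ex_derive_continuous (fun y => sin y - y * cos y)). auto_derive. exact I.
  - rewrite Rmin_left, Rmax_right in Hc by lra.
    rewrite sin_0 in E.
    assert (0 <= sin c) by (apply sin_ge_0; lra).
    assert (0 <= c * sin c * (t - 0)) by (repeat apply Rmult_le_pos; lra).
    lra.
Qed.

(** Both bounds come from $t\cos t \le \sin t \le t$: cleared of denominators, the upper one is
    $t^2\cos^2 t \le \sin^2 t$. *)
Lemma csc2_near x : 0 < x <= 1 / 2 ->
  / (PI * x) ^ 2 <= csc2 x <= / (PI * x) ^ 2 + 1.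
Proof.
  intros Hx. assert (P := PI_RGT_0). unfold csc2.
  assert (Hs := sin_PI_pos x ltac:(lra)).
  set (t := PI * x) in *.
  assert (Ht : 0 < t <= PI / 2) by (unfold t; nra).
  assert (H1 := sin_lt_x t ltac:(lra)).
  assert (H2 := x_cos_le_sin t ltac:(lra)).
  assert (Hc : 0 <= cos t) by (apply cos_ge_0; lra).
  assert (H := sin2_cos2 t). unfold Rsqr in H.
  split.
  - apply Rinv_le_contravar; [apply pow_lt; lra|]. nra.
  - apply Rmult_le_reg_r with (t ^ 2 * sin t ^ 2).
    { apply Rmult_lt_0_compat; apply pow_lt; lra. }
    replace (/ sin t ^ 2 * (t ^ 2 * sin t ^ 2)) with (t ^ 2) by (field; lra).
    replace ((/ t ^ 2 + 1) * (t ^ 2 * sin t ^ 2))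
      with (sin t ^ 2 + t ^ 2 * sin t ^ 2) by (field; lra).
    replace (sin t ^ 2) with (sin t * sin t) by ring.
    replace (t ^ 2) with (t * t) by ring.
    assert ((t * cos t) * (t * cos t) <= sin t * sin t) by (apply Rmult_le_compat; nra).
    nra.
Qed.

(** Two quantities within distance 1 have powers that agree up to one degree less. *)
Lemma pow_diff_bound k u v : 0 <= v <= u -> u <= v + 1 -> 1 <= u ->
  0 <= u ^ S k - v ^ S k <= INR (S k) * u ^ k.
Proof.
  intros Hv Hu H1; induction k as [|k IH]; [simpl; lra|].
  replace (u ^ S (S k) - v ^ S (S k)) with (u * (u ^ S k - v ^ S k) + (u - v) * v ^ S k)
    by (simpl; ring).
  assert (Hp : 0 <= v ^ S k <= u ^ S k) by (split; [apply pow_le|apply pow_incr]; lra).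
  assert (Hq : 0 <= u ^ k) by (apply pow_le; lra).
  rewrite (S_INR (S k)).
  replace ((INR (S k) + 1) * u ^ S k) with (u * (INR (S k) * u ^ k) + u ^ S k)
    by (simpl (u ^ S k); ring).
  split; nra.
Qed.

(** Near 0 both terms have the leading singularity $(\pi x)^{-2(j+1)}$, so the difference is smaller
    by one power of [csc2]. The symmetry $x \mapsto 1 - x$ covers the other half, and [csc2] being
    at least 1 absorbs bounded terms. *)
Lemma hur2_csc2_bound j : exists M, 0 <= M /\ forall x, 0 < x < 1 ->
  Rabs (csc2 x ^ S j - hur2 (2 * S j) x / PI ^ (2 * S j)) <= M * csc2 x ^ j.
Proof.
  set (s := (2 * S j)%nat). assert (Hs : (2 <= s)%nat) by (unfold s; lia).
  assert (P := PI_RGT_0).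
  assert (Pp : 0 < PI ^ s) by (apply pow_lt; lra).
  set (B := (hur s 1 + hur s (1 / 2)) / PI ^ s).
  assert (HB : 0 <= B).
  { apply Rmult_le_pos; [|apply Rlt_le, Rinv_0_lt_compat, Pp].
    assert (H1 := hur_pos s Hs 1 ltac:(lra)).
    assert (H2 := hur_pos s Hs (1/2) ltac:(lra)). lra. }
  exists (INR (S j) + B). split; [generalize (pos_INR (S j)); lra|].
  assert (Half : forall x, 0 < x <= 1 / 2 ->
    Rabs (csc2 x ^ S j - hur2 s x / PI ^ s) <= (INR (S j) + B) * csc2 x ^ j).
  { intros x Hx.
    assert (H1 := csc2_near x Hx). assert (H2 := csc2_ge1 x ltac:(lra)).
    assert (Hv : 0 <= / (PI * x) ^ 2).
    { apply Rlt_le, Rinv_0_lt_compat, pow_lt. nra. }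
    assert (H3 := pow_diff_bound j (csc2 x) (/ (PI * x) ^ 2) ltac:(lra) ltac:(lra) H2).
    assert (H4 := hur2_bound s Hs x Hx).
    assert (E : (/ (PI * x) ^ 2) ^ S j = / x ^ s / PI ^ s).
    { rewrite pow_inv, <- pow_mult. fold s. rewrite Rpow_mult_distr. field.
      split; [apply pow_nonzero|apply pow_nonzero]; lra. }
    rewrite E in H3.
    assert (H5 : 0 <= (hur2 s x - / x ^ s) / PI ^ s <= B).
    { unfold B, Rdiv. assert (Hi := Rinv_0_lt_compat _ Pp). split.
      - apply Rmult_le_pos; lra.
      - apply Rmult_le_compat_r; lra. }
    assert (H6 : 1 <= csc2 x ^ j) by (apply pow_R1_Rle; lra).
    assert (H7 : B <= B * csc2 x ^ j) by nra.
    replace (csc2 x ^ S j - hur2 s x / PI ^ s)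
      with (csc2 x ^ S j - / x ^ s / PI ^ s - (hur2 s x - / x ^ s) / PI ^ s)
      by (unfold Rdiv; ring).
    assert (0 <= INR (S j) * csc2 x ^ j) by (apply Rmult_le_pos; [apply pos_INR|lra]).
    apply Rabs_le. lra. }
  intros x Hx. destruct (Rle_lt_dec x (1 / 2)) as [H|H].
  - apply Half; lra.
  - rewrite <- csc2_sym, <- hur2_sym. apply Half; lra.
Qed.

(* Herglotz's trick: the difference of both sides is multiplied by [4^(S j)]
   under halving, while [csc2 ^ j] grows at most by the factor [2 * 4^j]. *)
Theorem hur2_ratpoly j : exists P, ratpoly (S j) P /\ forall x, 0 < x < 1 ->
  hur2 (2 * S j) x = PI ^ (2 * S j) * P (csc2 x).
Proof.
  set (s := (2 * S j)%nat). assert (Hs : (2 <= s)%nat) by (unfold s; lia).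
  assert (Pi := PI_RGT_0).
  assert (Pp : 0 < PI ^ s) by (apply pow_lt; lra).
  destruct (halving_eigenpoly j) as (P & r & HP & Hr & EP & EH).
  exists P. split; [exact HP|].
  destruct (hur2_csc2_bound j) as [M1 [HM1 B1]].
  destruct (ratpoly_bound j r Hr) as [M2 [HM2 B2]].
  set (h := fun x => P (csc2 x) - hur2 s x / PI ^ s).
  assert (Hb : forall n x, 0 < x < 1 -> Rabs (h x) <= (M1 + M2) * (1 / 2) ^ n * csc2 x ^ j).
  { induction n as [|n IH]; intros x Hx.
    - unfold h. rewrite EP.
      replace (csc2 x ^ S j + r (csc2 x) - hur2 s x / PI ^ s)
        with ((csc2 x ^ S j - hur2 s x / PI ^ s) + r (csc2 x)) by ring.
      eapply Rle_trans; [apply Rabs_triang|].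
      specialize (B1 x Hx). specialize (B2 _ (csc2_ge1 x Hx)). fold s in B1.
      rewrite pow_O. lra.
    - assert (Hh := csc2_halves x Hx).
      assert (E : 4 ^ S j * h x = h (x / 2) + h ((x + 1) / 2)).
      { unfold h. specialize (EH _ _ _ Hh).
        assert (D := hur2_double s Hs x Hx).
        assert (E4 : 2 ^ s = 4 ^ S j).
        { unfold s. rewrite pow_mult. f_equal. ring. }
        rewrite E4 in D.
        replace (P (csc2 (x / 2)) - hur2 s (x / 2) / PI ^ s +
           (P (csc2 ((x + 1) / 2)) - hur2 s ((x + 1) / 2) / PI ^ s))
         with (P (csc2 (x / 2)) + P (csc2 ((x + 1) / 2)) -
           (hur2 s (x / 2) + hur2 s ((x + 1) / 2)) / PI ^ s) by (unfold Rdiv; ring).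
        rewrite EH, D. unfold Rdiv. ring. }
      assert (I1 := IH (x / 2) ltac:(lra)).
      assert (I2 := IH ((x + 1) / 2) ltac:(lra)).
      assert (G1 := csc2_ge1 (x / 2) ltac:(lra)).
      assert (G2 := csc2_ge1 ((x + 1) / 2) ltac:(lra)).
      destruct Hh as [Hh _].
      (* The values at the two halves are positive and sum to [4 * csc2 x], so each is at most
         that. *)
      assert (J1 : csc2 (x / 2) ^ j <= 4 ^ j * csc2 x ^ j).
      { rewrite <- Rpow_mult_distr. apply pow_incr. lra. }
      assert (J2 : csc2 ((x + 1) / 2) ^ j <= 4 ^ j * csc2 x ^ j).
      { rewrite <- Rpow_mult_distr. apply pow_incr. lra. }
      set (A := (M1 + M2) * (1 / 2) ^ n) in *.
      assert (HA : 0 <= A) by (apply Rmult_le_pos; [lra|apply pow_le; lra]).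
      assert (F4 : 0 < 4 ^ j) by (apply pow_lt; lra).
      assert (T : Rabs (4 ^ S j * h x) <= A * (2 * (4 ^ j * csc2 x ^ j))).
      { rewrite E. eapply Rle_trans; [apply Rabs_triang|]. nra. }
      rewrite Rabs_mult, (Rabs_right (4 ^ S j)) in T by (apply Rle_ge, pow_le; lra).
      apply Rmult_le_reg_l with (4 ^ S j); [apply pow_lt; lra|].
      eapply Rle_trans; [exact T|].
      replace ((M1 + M2) * (1 / 2) ^ S n) with (A * (1 / 2)) by (unfold A; simpl; ring).
      simpl. apply Req_le. field. }
  intros x Hx.
  assert (Z : h x = 0).
  { set (A := (M1 + M2) * csc2 x ^ j).
    assert (HA : 0 <= A).
    { apply Rmult_le_pos; [lra|]. apply pow_le. generalize (csc2_ge1 x Hx); lra. }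
    destruct (Req_dec (h x) 0) as [|Hne]; [assumption|exfalso].
    assert (Hp := Rabs_pos_lt _ Hne).
    (* Dividing by [A + 1] rather than [A] keeps the threshold meaningful when [A] is zero. *)
    destruct (pow_lt_1_zero (1 / 2) ltac:(rewrite Rabs_right; lra)
                (Rabs (h x) / (A + 1)) ltac:(apply Rdiv_lt_0_compat; lra)) as [n Hn].
    specialize (Hn n (le_n n)). specialize (Hb n x Hx).
    rewrite Rabs_right in Hn by (apply Rle_ge, pow_le; lra).
    assert (Hq : 0 <= (1 / 2) ^ n) by (apply pow_le; lra).
    assert (Rabs (h x) <= A * (1 / 2) ^ n) by (unfold A; lra).
    apply Rmult_lt_compat_r with (r := A + 1) in Hn; [|lra].
    unfold Rdiv in Hn at 2. rewrite Rmult_assoc, Rinv_l in Hn by lra. nra. }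
  unfold h in Z. assert (hur2 s x / PI ^ s = P (csc2 x)) as <- by lra.
  field. lra.
Qed.

(** * Subfields of the complex numbers and conjugates of 2 cos (2 pi / n) *)

Open Scope C_scope.

Definition cis (x : R) : C := (cos x, sin x).

Definition theta (n c : nat) : R := (2 * cos (2 * PI * INR c / INR n))%R.

Definition Ceval (p : list C) (x : C) : C :=
  fold_right (fun a s => a + x * s) 0 p.

Lemma cis_plus (x y : R) : cis (x + y) = cis x * cis y.
Proof.
  unfold cis, Cmult; simpl; rewrite cos_plus, sin_plus; f_equal; ring.
Qed.

Lemma cis_pow (x : R) (n : nat) : cis x ^ n = cis (INR n * x).
Proof.
  induction n as [|n IH].
  - simpl. unfold cis. rewrite Rmult_0_l, cos_0, sin_0. reflexivity.
  - rewrite Cpow_S, IH, <- cis_plus, S_INR. f_equal. ring.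
Qed.

Lemma zeta_root_pow (n c : nat) :
  zeta_root n ^ c = cis (2 * PI * INR c / INR n).
Proof.
  change (zeta_root n) with (cis (2 * PI / INR n)).
  rewrite cis_pow. f_equal. unfold Rdiv. ring.
Qed.

Lemma zeta_root_pow_order (n : nat) : (0 < n)%nat -> zeta_root n ^ n = 1.
Proof.
  intros H. rewrite zeta_root_pow.
  replace (2 * PI * INR n / INR n)%R with (2 * PI)%R.
  - unfold cis. rewrite cos_2PI, sin_2PI. reflexivity.
  - field. apply not_0_INR. lia.
Qed.

Lemma cos_eq_1_period (x : R) : (0 < x < 2 * PI)%R -> cos x <> 1%R.
Proof.
  intros Hx H.
  assert (Hs : (0 < sin (x / 2))%R) by (apply sin_gt_0; lra).
  replace x with (2 * (x / 2))%R in H by field.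
  rewrite cos_2a_sin in H. nra.
Qed.

Lemma angle_range (n c : nat) :
  (0 < c < n)%nat -> (0 < 2 * PI * INR c / INR n < 2 * PI)%R.
Proof.
  intros [H0 H1].
  assert (P := PI_RGT_0).
  assert (Hc : (0 < INR c)%R) by (apply lt_0_INR; lia).
  assert (Hn : (INR c < INR n)%R) by (apply lt_INR; lia).
  split.
  - apply Rdiv_lt_0_compat; nra.
  - apply Rmult_lt_reg_r with (INR n); [lra|].
    unfold Rdiv. rewrite Rmult_assoc, Rinv_l by lra. nra.
Qed.

Lemma zeta_root_pow_neq1 (n c : nat) :
  (0 < c < n)%nat -> zeta_root n ^ c <> 1.
Proof.
  intros H E. rewrite zeta_root_pow in E.
  apply (f_equal fst) in E. simpl in E.
  exact (cos_eq_1_period _ (angle_range n c H) E).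
Qed.

Lemma theta_zeta_root (n c : nat) :
  RtoC (theta n c) = zeta_root n ^ c + / (zeta_root n ^ c).
Proof.
  rewrite zeta_root_pow. unfold theta. set (x := (2 * PI * INR c / INR n)%R).
  assert (h := sin2_cos2 x). unfold Rsqr in h.
  unfold Cinv, cis, Cplus, RtoC; simpl.
  replace (cos x * (cos x * 1) + sin x * (sin x * 1))%R with 1%R by lra.
  apply injective_projections; simpl; field.
Qed.

Section Subfields.
Variable F : C -> Prop.
Hypothesis HF : is_subfield F.

Lemma subfield_0 : F 0. Proof. apply HF. Qed.
Lemma subfield_1 : F 1. Proof. apply HF. Qed.
Lemma subfield_plus x y : F x -> F y -> F (x + y). Proof. apply HF. Qed.
Lemma subfield_opp x : F x -> F (- x). Proof. apply HF. Qed.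
Lemma subfield_mult x y : F x -> F y -> F (x * y). Proof. apply HF. Qed.
Lemma subfield_minus x y : F x -> F y -> F (x - y).
Proof.
  intros; apply subfield_plus; [|apply subfield_opp]; assumption.
Qed.
(** This default value gives closure under inversion without a side condition, the form in which
    [minimal_poly] asks for it. *)
Lemma Cinv_0 : / 0 = 0.
Proof. unfold Cinv; simpl. unfold Rdiv. apply injective_projections; simpl; ring. Qed.
Lemma subfield_inv x : F x -> F (/ x).
Proof.
  intros H. destruct (classic (x = 0)) as [->|Hx].
  - rewrite Cinv_0. exact subfield_0.
  - apply HF; assumption.
Qed.
Lemma subfield_pow x n : F x -> F (x ^ n).
Proof.
  intros H; induction n; [exact subfield_1|]. apply subfield_mult; assumption.
Qed.
Lemma subfield_INR n : F (RtoC (INR n)).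
Proof.
  induction n; [exact subfield_0|].
  rewrite S_INR, RtoC_plus. apply subfield_plus; [assumption|exact subfield_1].
Qed.
Lemma subfield_rat x : is_rat_C x -> F x.
Proof.
  assert (HP : forall p, F (RtoC (IZR (Zpos p)))).
  { intros p. unfold IZR. rewrite <- INR_IPR. apply subfield_INR. }
  assert (HZ : forall a, F (RtoC (IZR a))).
  { intros [|p|p]; [exact subfield_0|apply HP|].
    change (Zneg p) with (- Zpos p)%Z. rewrite opp_IZR, RtoC_opp. apply subfield_opp, HP. }
  intros (a & b & ->). unfold Rdiv. rewrite RtoC_mult.
  apply subfield_mult; [apply HZ|].
  rewrite RtoC_inv by (apply IZR_neq; discriminate). apply subfield_inv, HP.
Qed.
End Subfields.

Lemma adjoin_subfield (K : C -> Prop) (a : C) : is_subfield (adjoin K a).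
Proof.
  refine (conj _ (conj _ (conj _ (conj _ (conj _ _))))); unfold adjoin.
  - intros F HF _ _. exact (subfield_0 F HF).
  - intros F HF _ _. exact (subfield_1 F HF).
  - intros x y Hx Hy F HF HK Ha.
    exact (subfield_plus F HF x y (Hx F HF HK Ha) (Hy F HF HK Ha)).
  - intros x Hx F HF HK Ha. exact (subfield_opp F HF x (Hx F HF HK Ha)).
  - intros x y Hx Hy F HF HK Ha.
    exact (subfield_mult F HF x y (Hx F HF HK Ha) (Hy F HF HK Ha)).
  - intros x Hx _ F HF HK Ha. exact (subfield_inv F HF x (Hx F HF HK Ha)).
Qed.

Lemma adjoin_gen (K : C -> Prop) (a : C) : adjoin K a a.
Proof. unfold adjoin; auto. Qed.

(** * Transfer between the two models of the complex numbers *)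

Module ComplexBridge.
Import all_boot all_order all_algebra complex Rstruct.
Import GRing.Theory Num.Theory.
Import Algebraic.
Local Open Scope ring_scope.

Definition toC (z : Complex.C) : Rdefinitions.R[i] := mathcomp.real_closed.complex.Complex (fst z) (snd z).
Definition ofC (z : Rdefinitions.R[i]) : Complex.C := (complex.Re z, complex.Im z).

Lemma ofCK z : toC (ofC z) = z. Proof. by case: z. Qed.
Lemma toCK z : ofC (toC z) = z. Proof. by case: z. Qed.
Lemma toC0 : toC (RtoC 0) = 0. Proof. by []. Qed.
Lemma toC1 : toC (RtoC 1) = 1. Proof. by []. Qed.
Lemma toCD x y : toC (Cplus x y) = toC x + toC y.
Proof. by case: x y => [a b] [c d]. Qed.
Lemma toCN x : toC (Copp x) = - toC x.
Proof. by case: x. Qed.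
Lemma toCM x y : toC (Cmult x y) = toC x * toC y.
Proof. by case: x y => [a b] [c d]. Qed.
Lemma toCX x n : toC (Cpow x n) = toC x ^+ n.
Proof. by elim: n => [|n IH]; rewrite ?expr0 // exprS /= toCM IH. Qed.
Lemma toC_inj : injective toC.
Proof. exact: can_inj toCK. Qed.
Lemma toCV x : toC (Cinv x) = (toC x)^-1.
Proof.
have [->|x0] := classic (x = RtoC 0).
  by rewrite Cinv_0 toC0 invr0.
have x0' : toC x != 0 by apply/eqP; rewrite -toC0 => /toC_inj.
by apply: (mulfI x0'); rewrite -toCM Cinv_r // mulfV.
Qed.

Lemma toC_INR n : toC (RtoC (INR n)) = n%:R.
Proof.
elim: n => [//|n IH]; rewrite S_INR RtoC_plus toCD IH toC1.
by rewrite -addn1 natrD.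
Qed.

Lemma toC_Zpos p : toC (RtoC (IZR (Zpos p))) = (Pos.to_nat p)%:R.
Proof. by rewrite -toC_INR INR_IPR. Qed.

Lemma toC_rat z : is_rat_C z -> exists r : rat, toC z = ratr r.
Proof.
move=> [a [b ->]].
have [m hm] : exists m : int, toC (RtoC (IZR a)) = m%:~R.
  case: a => [|p|p].
  - by exists 0.
  - by exists (Posz (Pos.to_nat p)); rewrite toC_Zpos.
  - exists (- Posz (Pos.to_nat p)).
    by rewrite -Pos2Z.opp_pos opp_IZR RtoC_opp toCN toC_Zpos rmorphN.
exists (m%:~R / (Pos.to_nat b)%:R).
have nz : IZR (Zpos b) <> IZR 0 by exact: IZR_neq.
rewrite /Rdiv RtoC_mult toCM hm RtoC_inv // toCV toC_Zpos.
by rewrite fmorph_div rmorph_int rmorph_nat.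
Qed.

Lemma toC_subring F : is_subfield F -> subring (fun x => F (ofC x)).
Proof.
move=> HF; split.
- exact: (subfield_0 F HF).
- exact: (subfield_1 F HF).
- move=> x y Fx Fy; rewrite -(ofCK x) -(ofCK y) -toCN -toCD toCK.
  exact: (subfield_minus F HF).
- move=> x y Fx Fy; rewrite -(ofCK x) -(ofCK y) -toCM toCK.
  exact: (subfield_mult F HF).
Qed.

Lemma toC_subinv F : is_subfield F ->
  forall x, F (ofC x) -> F (ofC x^-1).
Proof.
move=> HF x Fx; rewrite -(ofCK x) -toCV toCK; exact: (subfield_inv F HF).
Qed.

Lemma prim_zeta_root n : (0 < n)%N -> n.-primitive_root (toC (zeta_root n)).
Proof.
move=> n0; apply/andP; split => //; apply/forallP => i.
rewrite unity_rootE -toCX -toC1 (inj_eq toC_inj).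
apply/eqP; apply/eqP/eqP => [e|->]; last by apply: zeta_root_pow_order; apply/ltP.
have := ltn_ord i; rewrite leq_eqVlt => /orP[/eqP//|lt].
case: (zeta_root_pow_neq1 n i.+1) => //.
by split; apply/ltP.
Qed.

Lemma unity_root_in_subfield F n z : (0 < n)%N -> is_subfield F ->
  F (zeta_root n) -> Cpow z n = RtoC 1 -> F z.
Proof.
move=> n0 HF Fz zn.
have [|c hc] := prim_rootP (prim_zeta_root n n0) (x := toC z).
  by rewrite -toCX zn.
move: hc; rewrite -toCX => /toC_inj ->; exact: subfield_pow.
Qed.

Lemma toC_Ceval p x : toC (Ceval p x) = (Poly (map toC p)).[toC x].
Proof.
elim: p => [|a p IH] /=; first by rewrite horner0.
by rewrite toCD toCM IH horner_cons mulrC addrC.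
Qed.

Lemma toC_theta n c : (0 < n)%N ->
  toC (RtoC (theta n c)) = toC (zeta_root n) ^+ c + toC (zeta_root n) ^- c.
Proof.
move=> n0; rewrite -toCX -toCV -toCD; congr toC.
exact: theta_zeta_root.
Qed.

(** The transport principle: [real_conjugate_root] with [E] the real cyclotomic subfield, which
    contains every $\zeta^c + \zeta^{-c}$. *)
Lemma zeta_conjugate_root (F : Complex.C -> Prop) n b (p : list Complex.C) :
  (0 < n)%N -> is_subfield F ->
  (forall z, F z -> cyclo_plus n z -> is_rat_C z) ->
  coprime b n -> List.Forall F p ->
  Ceval p (RtoC (theta n 1)) = RtoC 0 -> Ceval p (RtoC (theta n b)) = RtoC 0.
Proof.
move=> n0 HF HR cb Fp e1.
have HQ := adjoin_subfield is_rat_C (zeta_root n).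
apply: toC_inj; rewrite toC_Ceval toC_theta // toC0; apply/rootP.
apply: (@real_conjugate_root _ (fun x => F (ofC x)) (fun x => cyclo_plus n (ofC x)) n).
- exact: toC_subring.
- exact: toC_subinv.
- have [E0 E1 EB EM] := toC_subring _ HQ; split.
  + by split.
  + by split.
  + move=> x y [hx ix] [hy iy]; split; first exact: EB.
    by case: x y hx hy ix iy => [a b'] [c d] /= _ _ -> ->; rewrite /= subrr.
  + move=> x y [hx ix] [hy iy]; split; first exact: EM.
    by case: x y hx hy ix iy => [a b'] [c d] /= _ _ -> ->; rewrite /= mulr0 mul0r addr0.
- exact: prim_zeta_root.
- move=> c; split; last by rewrite -toC_theta.
  rewrite -toCX -toCV -toCD toCK; apply: (subfield_plus _ HQ).
    by apply: (subfield_pow _ HQ); exact: adjoin_gen.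
  by apply: (subfield_inv _ HQ); apply: (subfield_pow _ HQ); exact: adjoin_gen.
- by move=> x Fx Ex; rewrite -(ofCK x); apply: toC_rat; apply: HR.
- by [].
- move=> i; rewrite coef_Poly.
  elim: p Fp i {e1} => [|a p IH] Fp i /=; first by rewrite nth_nil; exact: (subfield_0 F HF).
  inversion Fp; subst; case: i => [|i] /=; first by rewrite toCK.
  exact: IH.
- rewrite rootE; move: e1 => /(congr1 toC); rewrite toC_Ceval toC_theta // expr1 => ->.
  by rewrite toC0.
Qed.

End ComplexBridge.

(** * Finite complex sums and trigonometric identities for [theta] *)

Fixpoint Csum (f : nat -> C) (n : nat) : C :=
  match n with O => 0 | S m => Csum f m + f m end.

Lemma Csum_ext f g n :
  (forall i, (i < n)%nat -> f i = g i) -> Csum f n = Csum g n.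
Proof.
  induction n as [|n IH]; intros H; simpl; [reflexivity|].
  rewrite IH by (intros; apply H; lia). rewrite H by lia. reflexivity.
Qed.

Lemma Csum_plus f g n : Csum (fun i => f i + g i) n = Csum f n + Csum g n.
Proof. induction n as [|n IH]; simpl; [ring|]. rewrite IH; ring. Qed.

Lemma Csum_scal c f n : Csum (fun i => c * f i) n = c * Csum f n.
Proof. induction n as [|n IH]; simpl; [ring|]. rewrite IH; ring. Qed.

Lemma Csum_first f n : Csum f (S n) = f O + Csum (fun i => f (S i)) n.
Proof.
  induction n as [|n IH]; [simpl; ring|].
  change (Csum f (S n) + f (S n) = f O + (Csum (fun i => f (S i)) n + f (S n))).
  rewrite IH. ring.
Qed.

Lemma Csum_rev f n : Csum (fun i => f (n - i)%nat) (S n) = Csum f (S n).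
Proof.
  induction n as [|n IH]; [reflexivity|].
  rewrite Csum_first. change (Csum f (S (S n))) with (Csum f (S n) + f (S n)).
  rewrite <- IH. rewrite Nat.sub_0_r. rewrite Cplus_comm. reflexivity.
Qed.

Lemma Re_Csum f n : Re (Csum f n) = Rsum (fun i => Re (f i)) n.
Proof. induction n as [|n IH]; simpl; [reflexivity|]. rewrite <- IH. reflexivity. Qed.

Lemma Im_Csum f n : Im (Csum f n) = Rsum (fun i => Im (f i)) n.
Proof. induction n as [|n IH]; simpl; [reflexivity|]. rewrite <- IH. reflexivity. Qed.

Lemma RtoC_Rsum f n : RtoC (Rsum f n) = Csum (fun i => RtoC (f i)) n.
Proof. induction n as [|n IH]; simpl; [reflexivity|]. rewrite RtoC_plus, IH. reflexivity. Qed.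

Lemma INR_neq0 n : (0 < n)%nat -> INR n <> 0%R.
Proof. intros; apply not_0_INR; lia. Qed.

Lemma theta_0 N : theta N 0 = 2%R.
Proof.
  unfold theta. simpl. replace (2 * PI * 0 / INR N)%R with 0%R by (unfold Rdiv; ring).
  rewrite cos_0. ring.
Qed.

Lemma theta_rec N j m :
  (theta N (S (S j) * m) = theta N m * theta N (S j * m) - theta N (j * m))%R.
Proof.
  unfold theta.
  set (a := (2 * PI * INR m / INR N)%R).
  replace (2 * PI * INR (S (S j) * m) / INR N)%R
    with (a + 2 * PI * INR (S j * m) / INR N)%R
    by (unfold a, Rdiv; rewrite !mult_INR, !S_INR; ring).
  replace (2 * PI * INR (j * m) / INR N)%R
    with (2 * PI * INR (S j * m) / INR N - a)%R
    by (unfold a, Rdiv; rewrite !mult_INR, !S_INR; ring).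
  rewrite cos_plus, cos_minus. ring.
Qed.

Lemma theta_period N m j : (0 < N)%nat -> theta N (m + j * N) = theta N m.
Proof.
  intros HN. unfold theta. f_equal.
  replace (2 * PI * INR (m + j * N) / INR N)%R
    with (2 * PI * INR m / INR N + 2 * INR j * PI)%R.
  - apply cos_period.
  - rewrite plus_INR, mult_INR. field. apply INR_neq0, HN.
Qed.

Lemma theta_pred N m : (0 < N)%nat -> theta N ((N - 1) * m) = theta N m.
Proof.
  intros HN. unfold theta. f_equal.
  replace (2 * PI * INR ((N - 1) * m) / INR N)%R
    with (- (2 * PI * INR m / INR N) + 2 * INR m * PI)%R.
  - rewrite cos_period, cos_neg. reflexivity.
  - rewrite mult_INR, minus_INR by lia. simpl (INR 1). field. apply INR_neq0, HN.
Qed.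

Lemma theta_neq2 N m : (0 < N)%nat -> (m mod N <> 0)%nat -> theta N m <> 2%R.
Proof.
  intros HN Hm.
  rewrite (Nat.div_mod_eq m N), Nat.add_comm, Nat.mul_comm, theta_period by exact HN.
  intros E. unfold theta in E.
  apply (cos_eq_1_period (2 * PI * INR (m mod N) / INR N)); [|lra].
  apply angle_range. split; [lia|]. apply Nat.mod_upper_bound. lia.
Qed.

(** Also valid at multiples of [N], where both sides take the default value of a division by zero;
    [csc2_period] uses this. *)
Lemma csc2_theta N m : csc2 (INR m / INR N) = (4 / (2 - theta N m))%R.
Proof.
  unfold csc2.
  assert (E : (2 - theta N m = 4 * sin (PI * (INR m / INR N)) ^ 2)%R).
  { unfold theta.
    replace (2 * PI * INR m / INR N)%R with (2 * (PI * (INR m / INR N)))%R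
      by (unfold Rdiv; ring).
    rewrite cos_2a_sin. ring. }
  rewrite E. set (t := (sin _ ^ 2)%R).
  unfold Rdiv. rewrite Rinv_mult, <- Rmult_assoc, Rinv_r by lra. ring.
Qed.

(** By [theta_rec], multiplication by $2 - \theta_m$ is minus the second difference in $j$, so the
    sum telescopes; the boundary terms cancel by periodicity and evenness of the cosine. *)
Lemma theta_sum0 N m : (0 < N)%nat -> theta N m <> 2%R ->
  Rsum (fun j => theta N (j * m)) N = 0%R.
Proof.
  intros HN Hm. set (t := fun j => theta N (j * m)).
  assert (E : forall n, ((2 - theta N m) * Rsum t (S n)
     = t n - t (S n) + (2 - theta N m))%R).
  { induction n as [|n IH].
    - unfold t; simpl. rewrite Nat.add_0_r, theta_0. ring.
    - change (Rsum t (S (S n))) with (Rsum t (S n) + t (S n))%R.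
      rewrite Rmult_plus_distr_l, IH. unfold t. rewrite theta_rec. ring. }
  specialize (E (N - 1)%nat). replace (S (N - 1)) with N in E by lia.
  unfold t in E at 2 3. rewrite theta_pred in E by exact HN.
  replace (N * m)%nat with (0 + m * N)%nat in E by lia.
  rewrite theta_period, theta_0 in E by exact HN.
  assert (F : ((2 - theta N m) * Rsum t N = 0)%R) by lra.
  apply Rmult_integral in F. destruct F; [lra|assumption].
Qed.

(* Discrete summation by parts: the second difference of [j (N - j)] is
   constant. *)
Lemma csc2_theta_sum N m : (0 < N)%nat -> (m mod N <> 0)%nat ->
  csc2 (INR m / INR N)
  = Rsum (fun j => - / INR N * (INR j * (INR N - INR j)) * theta N (j * m))%R N.
Proof.
  intros HN Hm'. assert (Hm := theta_neq2 N m HN Hm').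
  rewrite csc2_theta.
  set (f := fun j => (INR j * (INR N - INR j))%R).
  set (t := fun j => theta N (j * m)).
  rewrite (Rsum_ext _ (fun j => - / INR N * (f j * t j))%R)
    by (intros; unfold f, t; ring).
  rewrite Rsum_scal.
  assert (E : forall n, ((2 - theta N m) * Rsum (fun j => f j * t j) (S n)
     = 2 * Rsum t (S n) + (f (S n) * t n - f n * t (S n)) - 2 * INR N - 2)%R).
  { induction n as [|n IH].
    - unfold f, t; simpl. rewrite Nat.add_0_r, theta_0. ring.
    - change (Rsum t (S (S n))) with (Rsum t (S n) + t (S n))%R.
      change (Rsum (fun j => f j * t j) (S (S n)))%R
        with (Rsum (fun j => f j * t j) (S n) + f (S n) * t (S n))%R.
      rewrite Rmult_plus_distr_l, IH. unfold t, f. rewrite theta_rec, !S_INR. ring. }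
  specialize (E (N - 1)%nat). replace (S (N - 1)) with N in E by lia.
  unfold t in E at 2 3 4. rewrite theta_sum0, theta_pred in E by assumption.
  replace (N * m)%nat with (0 + m * N)%nat in E by lia.
  rewrite theta_period, theta_0 in E by exact HN.
  unfold f in E at 2 3. rewrite minus_INR in E by lia. simpl (INR 1) in E.
  (* The full sum of the thetas vanishes and [f N = 0], so only $-2(N-1) - 2N - 2 = -4N$ is left. *)
  assert (E' : ((2 - theta N m) * Rsum (fun j => f j * t j) N = - 4 * INR N)%R)
    by (rewrite E; ring).
  assert (HN' := INR_neq0 N HN).
  apply Rmult_eq_reg_l with (2 - theta N m)%R; [|lra].
  rewrite Rmult_comm, <- Rmult_assoc, (Rmult_comm (2 - theta N m)), Rmult_assoc.
  rewrite E'. field. split; lra.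
Qed.

(** * Polynomials over $F$ evaluated at all conjugates at once *)

Lemma Ceval_const c x : Ceval [c] x = c.
Proof. unfold Ceval; simpl. ring. Qed.

Fixpoint Cpadd (p q : list C) : list C :=
  match p, q with
  | [], _ => q
  | _, [] => p
  | a :: p', b :: q' => (a + b) :: Cpadd p' q'
  end.

Lemma Ceval_add p q x : Ceval (Cpadd p q) x = Ceval p x + Ceval q x.
Proof.
  unfold Ceval; revert q; induction p as [|a p IH]; intros [|b q]; simpl;
    [ring|ring|ring|]. rewrite IH. ring.
Qed.

Definition Cpscal (c : C) (p : list C) : list C := map (Cmult c) p.

Lemma Ceval_scal c p x : Ceval (Cpscal c p) x = c * Ceval p x.
Proof.
  unfold Ceval; induction p as [|a p IH]; simpl; [ring|]. rewrite IH. ring.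
Qed.

Fixpoint Cpmul (p q : list C) : list C :=
  match p with
  | [] => []
  | a :: p' => Cpadd (Cpscal a q) (RtoC 0 :: Cpmul p' q)
  end.

Lemma Ceval_mul p q x : Ceval (Cpmul p q) x = Ceval p x * Ceval q x.
Proof.
  induction p as [|a p IH]; [unfold Ceval; simpl; ring|].
  simpl Cpmul. rewrite Ceval_add, Ceval_scal.
  change (Ceval (RtoC 0 :: Cpmul p q) x) with (RtoC 0 + x * Ceval (Cpmul p q) x).
  change (Ceval (a :: p) x) with (a + x * Ceval p x). rewrite IH. ring.
Qed.

Section Representable.
Variables (F : C -> Prop) (N : nat).
Hypothesis HF : is_subfield F.

(* [g b] is the [b]-th conjugate of an element of [F[theta N 1]]. *)
Definition representable (g : nat -> C) : Prop :=
  exists p, List.Forall F p /\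
    forall b, Nat.gcd b N = 1%nat -> Ceval p (RtoC (theta N b)) = g b.

Lemma Forall_padd p q :
  List.Forall F p -> List.Forall F q -> List.Forall F (Cpadd p q).
Proof.
  intros Hp; revert q; induction Hp as [|a p Ha Hp IH]; intros [|b q] Hq; simpl;
    auto.
  inversion Hq; subst. constructor; [apply (subfield_plus F HF); assumption|auto].
Qed.

Lemma Forall_pscal c p : F c -> List.Forall F p -> List.Forall F (Cpscal c p).
Proof.
  intros Hc Hp; induction Hp as [|a p Ha Hp IH]; simpl; constructor; auto.
  apply (subfield_mult F HF); assumption.
Qed.

Lemma Forall_pmul p q :
  List.Forall F p -> List.Forall F q -> List.Forall F (Cpmul p q).
Proof.
  intros Hp Hq; induction Hp as [|a p Ha Hp IH]; simpl; [constructor|].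
  apply Forall_padd; [apply Forall_pscal; assumption|].
  constructor; [exact (subfield_0 F HF)|assumption].
Qed.

Lemma representable_ext g h : representable g ->
  (forall b, Nat.gcd b N = 1%nat -> h b = g b) -> representable h.
Proof.
  intros [p [Hp E]] H. exists p. split; [exact Hp|].
  intros b Hb. rewrite H by exact Hb. apply E, Hb.
Qed.

Lemma representable_const c : F c -> representable (fun _ => c).
Proof.
  intros Hc. exists [c]. split; [repeat constructor; exact Hc|].
  intros; apply Ceval_const.
Qed.

Lemma representable_plus g h : representable g -> representable h ->
  representable (fun b => g b + h b).
Proof.
  intros [p [Hp Ep]] [r [Hr Er]]. exists (Cpadd p r).
  split; [apply Forall_padd; assumption|].
  intros b Hb. rewrite Ceval_add, Ep, Er by exact Hb. reflexivity.
Qed.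

Lemma representable_mult g h : representable g -> representable h ->
  representable (fun b => g b * h b).
Proof.
  intros [p [Hp Ep]] [r [Hr Er]]. exists (Cpmul p r).
  split; [apply Forall_pmul; assumption|].
  intros b Hb. rewrite Ceval_mul, Ep, Er by exact Hb. reflexivity.
Qed.

Lemma representable_sum (g : nat -> nat -> C) n :
  (forall i, (i < n)%nat -> representable (g i)) ->
  representable (fun b => Csum (fun i => g i b) n).
Proof.
  induction n as [|n IH]; intros H; simpl.
  - apply representable_const. exact (subfield_0 F HF).
  - apply (representable_plus (fun b => Csum (fun i => g i b) n) (g n)).
    + apply IH. intros; apply H; lia.
    + apply H; lia.
Qed.

Lemma representable_theta c : representable (fun b => RtoC (theta N (c * b))).
Proof.
  enough (H : forall d, (d <= c)%nat ->
    representable (fun b => RtoC (theta N (d * b)))) by (apply H; lia).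
  assert (H1 : representable (fun b => RtoC (theta N b))).
  { exists [RtoC 0; RtoC 1]. split.
    - repeat constructor; [exact (subfield_0 F HF)|exact (subfield_1 F HF)].
    - intros; unfold Ceval; simpl; ring. }
  induction c as [|c IH]; intros d Hd.
  - replace d with 0%nat by lia. simpl.
    apply representable_const. rewrite theta_0.
    apply (subfield_INR F HF 2).
  - destruct (Nat.eq_dec d (S c)) as [->|]; [|apply IH; lia].
    destruct c as [|c].
    + apply (representable_ext _ _ H1). intros; rewrite Nat.mul_1_l; reflexivity.
    + apply (representable_ext (fun b => RtoC (theta N b) * RtoC (theta N (S c * b))
          + RtoC (-1) * RtoC (theta N (c * b)))).
      * apply representable_plus.
        -- apply representable_mult; [exact H1|apply IH; lia].
        -- apply representable_mult; [|apply IH; lia].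
           apply representable_const, (subfield_rat F HF), ratR_is_rat, (ratR_IZR (-1)).
      * intros b _. rewrite <- !RtoC_mult, <- RtoC_plus. f_equal.
        rewrite theta_rec. ring.
Qed.

Lemma representable_ratpoly d P (g : nat -> R) : ratpoly d P ->
  representable (fun b => RtoC (g b)) -> representable (fun b => RtoC (P (g b))).
Proof.
  intros HP Hg; induction HP as [a f Ha E|d a f' f Ha Hf IH E].
  - apply (representable_ext (fun _ => RtoC a)).
    + apply representable_const, (subfield_rat F HF), ratR_is_rat, Ha.
    + intros; rewrite E; reflexivity.
  - apply (representable_ext (fun b => RtoC a * RtoC (g b) ^ S d + RtoC (f' (g b)))).
    + apply representable_plus; [|exact IH]. apply representable_mult.
      * apply representable_const, (subfield_rat F HF), ratR_is_rat, Ha.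
      * generalize (S d); intros n; induction n as [|n IHn]; simpl.
        -- apply representable_const, (subfield_1 F HF).
        -- apply (representable_mult (fun b => RtoC (g b)) (fun b => RtoC (g b) ^ n));
             assumption.
    + intros; rewrite E, RtoC_plus, RtoC_mult, RtoC_pow. reflexivity.
Qed.

(** The expansion [csc2_theta_sum] avoids dividing by $2 - \theta_{cb}$, and its rational
    coefficients do not depend on $b$: one polynomial serves all conjugates. *)
Lemma representable_csc2 c : (0 < N)%nat -> (c mod N <> 0)%nat ->
  representable (fun b => RtoC (csc2 (INR (c * b) / INR N))).
Proof.
  intros HN Hc.
  apply (representable_ext (fun b => Csum (fun j =>
    RtoC (- / INR N * (INR j * (INR N - INR j)))%R * RtoC (theta N ((j * c) * b))) N)).
  - apply (representable_sum (fun j b =>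
      RtoC (- / INR N * (INR j * (INR N - INR j)))%R * RtoC (theta N ((j * c) * b)))).
    intros j _. apply representable_mult; [|apply representable_theta].
    apply representable_const. apply (subfield_rat F HF), ratR_is_rat.
    replace (- / INR N * (INR j * (INR N - INR j)))%R
      with (-1 * / INR N * (INR j * (INR N + -1 * INR j)))%R by ring.
    assert (M1 := ratR_IZR (-1)).
    repeat (apply ratR_mult || apply ratR_plus || apply ratR_inv || apply ratR_INR
            || exact M1).
  - intros b Hb. rewrite csc2_theta_sum.
    + rewrite RtoC_Rsum. apply Csum_ext. intros j _.
      rewrite <- RtoC_mult, Nat.mul_assoc. reflexivity.
    + exact HN.
    (* As [b] is prime to [N], the product [c * b] stays nonzero modulo [N]. *)
    + intros E. apply Hc. apply Nat.Lcm0.mod_divide in E. apply Nat.Lcm0.mod_divide.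
      apply Nat.gauss with b; [|rewrite Nat.gcd_comm; exact Hb].
      rewrite Nat.mul_comm. exact E.
Qed.

End Representable.

(** * Dirichlet characters and their L-values *)

Module Arithmetic.
Import all_boot all_order all_algebra cyclic complex Rstruct ComplexBridge.
Import GRing.Theory.
Local Open Scope nat_scope.

Lemma dvdn_divide d n : Nat.divide d n <-> d %| n.
Proof.
split=> [[k ->]|/dvdnP[k ->]]; first exact: dvdn_mull.
by exists k.
Qed.

Lemma coprime_gcd a b : Nat.gcd a b = 1 <-> coprime a b.
Proof.
suff -> : Nat.gcd a b = gcdn a b by rewrite /coprime; split => [->|/eqP].
apply/eqP; rewrite eqn_dvd; apply/andP; split.
  by rewrite dvdn_gcd; apply/andP; split; apply/dvdn_divide;
    [apply: Nat.gcd_divide_l|apply: Nat.gcd_divide_r].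
by apply/dvdn_divide; apply: Nat.gcd_greatest; apply/dvdn_divide;
  [apply: dvdn_gcdl|apply: dvdn_gcdr].
Qed.

Lemma totientE n : 0 < n -> Defs.totient n = prime.totient n.
Proof.
case: n => // n _.
have seqE m k : List.seq m k = iota m k by elim: k m => //= k IH m; rewrite IH.
have lenE (T : Type) (p : pred T) s : List.length (List.filter p s) = count p s.
  by elim: s => //= x s IH; case: (p x) => /=; rewrite IH.
have cntE (p : pred nat) s : count p s = \sum_(i <- s) (p i : nat).
  by elim: s => [|x s IH]; rewrite ?big_nil // big_cons /= IH.
have gcdE i : Nat.eqb (Nat.gcd i n.+1) 1 = coprime n.+1 i.
  by apply/Nat.eqb_spec/idP; rewrite coprime_sym => /coprime_gcd.
rewrite /Defs.totient seqE lenE cntE totient_count_coprime.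
have -> : iota 1 n.+1 = index_iota 1 n.+2 by rewrite /index_iota subn1.
rewrite (eq_bigr _ (fun i _ => congr1 nat_of_bool (gcdE i))).
(* One count runs over $1,\dots,n+1$, the other over $0,\dots,n$; the exchanged ends $n+1$ and $0$
   have the same gcd with $n+1$. *)
rewrite big_nat_recr // [RHS]big_ltn // addnC; congr addn.
by rewrite /coprime gcdnn gcdn0.
Qed.

Lemma totient_pos n : 0 < n -> 0 < Defs.totient n.
Proof. by move=> n0; rewrite totientE // totient_gt0. Qed.

Lemma Euler_totient a n : 0 < n -> 0 < a -> Nat.gcd a n = 1 ->
  exists k, Nat.pow a (Defs.totient n) = Nat.add 1 (Nat.mul k n).
Proof.
move=> n0 a0 /coprime_gcd co; rewrite totientE //.
have -> : Nat.pow a (prime.totient n) = a ^ prime.totient n.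
  by elim: (prime.totient n) => //= k ->; rewrite expnS.
have /eqP := Euler_exp_totient co.
have le : 1 <= a ^ prime.totient n by rewrite expn_gt0 a0.
rewrite eqn_mod_dvd // => /dvdnP[k e]; exists k.
by apply/eqP; rewrite -[Nat.add _ _]/(1 + k * n) -e subnKC.
Qed.

(** Multiplication by a unit is injective on residues modulo [q], hence permutes them. *)
Lemma Csum_mul_perm (G : nat -> Complex.C) q b : 0 < q ->
  (forall n, G (n %% q) = G n) -> Nat.gcd b q = 1 ->
  Csum (fun a => G (a * b)) q = Csum G q.
Proof.
move=> q0 Gper /coprime_gcd co; apply: toC_inj.
have sumE H : toC (Csum H q) = (\sum_(i < q) toC (H i))%R.
  elim: q {q0 Gper co} => [|q IH]; first by rewrite big_ord0.
  by rewrite big_ord_recr /= toCD IH.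
rewrite !sumE.
pose h (i : 'I_q) := Ordinal (ltn_pmod (i * b) q0).
have hinj : injective h.
  move=> i j /(congr1 val) /= /eqP.
  wlog le : i j / j <= i.
    by move=> W; case/orP: (leq_total j i) => ? e; [|symmetry]; apply: W; rewrite // eq_sym.
  rewrite eqn_mod_dvd ?leq_mul2r ?le ?orbT // -mulnBl Gauss_dvdl 1?coprime_sym // => dv.
  apply/val_inj/eqP; rewrite eqn_leq le andbT -subn_eq0; move: dv.
  have [->//|p] := posnP (i - j).
  move/(dvdn_leq p); rewrite leqNgt (leq_ltn_trans (leq_subr _ _)) //.
rewrite [RHS](reindex_inj hinj); apply: eq_bigr => i _ /=.
by rewrite Gper.
Qed.

Lemma modE a b : Nat.modulo a b = a %% b.
Proof.
case: b => [|b]; first by rewrite modn0.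
have := Nat.div_mod_eq a b.+1; set r := Nat.modulo _ _; set k := Nat.div _ _.
have lt : r < b.+1 by apply/ltP; apply: Nat.mod_upper_bound.
by move=> ->; rewrite -[Nat.add _ _]/(b.+1 * k + r) mulnC modnMDl modn_small.
Qed.
End Arithmetic.

Lemma Zgcd_of_nat (a b : nat) : Z.gcd (Z.of_nat a) (Z.of_nat b) = Z.of_nat (Nat.gcd a b).
Proof.
  apply Z.gcd_unique; [lia| | |].
  - destruct (Nat.gcd_divide_l a b) as [k E]. exists (Z.of_nat k). lia.
  - destruct (Nat.gcd_divide_r a b) as [k E]. exists (Z.of_nat k). lia.
  - intros d [x Hx] [y Hy].
    destruct (Nat.gcd_bezout a b) as [(u & v & E)|(u & v & E)];
      apply (f_equal Z.of_nat) in E;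
      rewrite Nat2Z.inj_add, !Nat2Z.inj_mul, Hx, Hy in E.
    + exists (Z.of_nat u * x - Z.of_nat v * y)%Z. lia.
    + exists (Z.of_nat u * y - Z.of_nat v * x)%Z. lia.
Qed.

Lemma Lval_term chi s n : chi (Z.of_nat (S n)) / RtoC (INR (S n) ^ s)
  = RtoC (/ INR (S n) ^ s) * chi (Z.of_nat (S n)).
Proof.
  unfold Cdiv. rewrite Cmult_comm, RtoC_inv; [reflexivity|].
  apply pow_nonzero, not_0_INR. lia.
Qed.

Lemma Re_real_mult (x : R) (z : C) : Re (RtoC x * z) = (x * Re z)%R.
Proof. unfold Re, RtoC; simpl. ring. Qed.

Lemma Im_real_mult (x : R) (z : C) : Im (RtoC x * z) = (x * Im z)%R.
Proof. unfold Im, RtoC; simpl. ring. Qed.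

Lemma ex_series_bounded_mult s (a : nat -> R) : (2 <= s)%nat ->
  (forall n, (Rabs (a n) <= 1)%R) -> ex_series (fun n => / INR (S n) ^ s * a n)%R.
Proof.
  intros Hs Ha.
  apply (ex_series_le (V := R_CompleteNormedModule) _ (fun n => / INR (S n) ^ s)%R).
  - intros n. change (Rabs (/ INR (S n) ^ s * a n) <= / INR (S n) ^ s)%R.
    assert (P : (0 < / INR (S n) ^ s)%R).
    { apply Rinv_0_lt_compat, pow_lt, lt_0_INR. lia. }
    rewrite Rabs_mult, Rabs_right by lra.
    specialize (Ha n). nra.
  - apply ex_series_inv_pow, Hs.
Qed.

Section Characters.
Variables (q : nat) (chi : Z -> C).
Hypothesis Hq : (2 < q)%nat.
Hypothesis Hchi : is_dirichlet_char q chi.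

Lemma char_mult m n : chi (m * n)%Z = chi m * chi n.
Proof. apply Hchi. Qed.

Lemma char_1 : chi 1%Z = 1.
Proof. apply Hchi. Qed.

Lemma char_0 n : chi n = 0 <-> Z.gcd n (Z.of_nat q) <> 1%Z.
Proof. apply Hchi. Qed.

Lemma char_period n k : chi (n + k * Z.of_nat q)%Z = chi n.
Proof.
  clear Hq.
  assert (P : forall n k, (0 <= k)%Z -> chi (n + k * Z.of_nat q)%Z = chi n).
  { clear n k. intros n k Hk. revert k Hk n. apply (natlike_ind (fun k => forall n,
      chi (n + k * Z.of_nat q)%Z = chi n)).
    - intros n; f_equal; lia.
    - intros k _ IH n.
      replace (n + Z.succ k * Z.of_nat q)%Z with ((n + k * Z.of_nat q) + Z.of_nat q)%Z by lia.
      rewrite (proj1 Hchi). apply IH. }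
  destruct (Z_le_dec 0 k) as [H|H]; [apply P, H|].
  rewrite <- (P (n + k * Z.of_nat q)%Z (- k)%Z) by lia. f_equal. lia.
Qed.

Lemma char_mod n : chi (n mod Z.of_nat q)%Z = chi n.
Proof.
  rewrite <- (char_period _ (n / Z.of_nat q)). f_equal.
  rewrite Z.mul_comm, Z.add_comm. symmetry. apply Z.div_mod. lia.
Qed.

Lemma char_mod_nat (n : nat) : chi (Z.of_nat (n mod q)) = chi (Z.of_nat n).
Proof. rewrite Nat2Z.inj_mod. apply char_mod. Qed.

Lemma char_at_0 : chi (Z.of_nat 0) = 0.
Proof. apply char_0. rewrite Z.gcd_0_l. lia. Qed.

Lemma char_at_q : chi (Z.of_nat q) = 0.
Proof. apply char_0. rewrite Z.gcd_diag. lia. Qed.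

Lemma char_pow n k : chi (n ^ Z.of_nat k)%Z = chi n ^ k.
Proof.
  induction k as [|k IH]; [exact char_1|].
  rewrite Nat2Z.inj_succ, Z.pow_succ_r by lia. rewrite char_mult, IH. reflexivity.
Qed.

Lemma char_unity_nat (a : nat) : Nat.gcd a q = 1%nat ->
  chi (Z.of_nat a) ^ totient q = 1.
Proof.
  intros Ha.
  assert (Ha0 : (0 < a)%nat).
  { destruct a; [|lia]. rewrite Nat.gcd_0_l in Ha. lia. }
  destruct (Arithmetic.Euler_totient a q) as [k E].
  { apply (ssrbool.introT ssrnat.ltP). lia. }
  { apply (ssrbool.introT ssrnat.ltP). lia. }
  { exact Ha. }
  rewrite <- char_pow, <- Nat2Z.inj_pow, E, Nat2Z.inj_add, Nat2Z.inj_mul, char_period.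
  exact char_1.
Qed.

Lemma char_unity n : Z.gcd n (Z.of_nat q) = 1%Z -> chi n ^ totient q = 1.
Proof.
  intros Hn. rewrite <- char_mod.
  assert (Hr := Z.mod_pos_bound n (Z.of_nat q) ltac:(lia)).
  rewrite <- (Z2Nat.id (n mod Z.of_nat q)) by lia.
  apply char_unity_nat. apply Nat2Z.inj.
  rewrite <- Zgcd_of_nat, Z2Nat.id, Z.gcd_mod_l by lia. exact Hn.
Qed.

Lemma totient_pos : (0 < totient q)%nat.
Proof.
  apply (ssrbool.elimT ssrnat.ltP), Arithmetic.totient_pos.
  apply (ssrbool.introT ssrnat.ltP). lia.
Qed.

Lemma char_Cmod n : (Cmod (chi n) <= 1)%R.
Proof.
  destruct (Z.eq_dec (Z.gcd n (Z.of_nat q)) 1) as [H|H].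
  - apply char_unity in H. apply (f_equal Cmod) in H. rewrite Cmod_pow, Cmod_1 in H.
    destruct (Rle_lt_dec (Cmod (chi n)) 1) as [|L]; [assumption|].
    assert (P := Rlt_pow_R1 _ _ L totient_pos). lra.
  - apply char_0 in H. rewrite H, Cmod_0. lra.
Qed.

(** A nonzero value is a root of unity of order dividing [totient q], hence a power of
    [zeta_root m]. This is the purpose of adjoining that root to $K$. *)
Lemma char_in_subfield F m n : is_subfield F -> (0 < m)%nat ->
  Nat.divide (totient q) m -> F (zeta_root m) -> F (chi n).
Proof.
  intros HF Hm [c Hc] Hz.
  destruct (Z.eq_dec (Z.gcd n (Z.of_nat q)) 1) as [H|H].
  - apply (ComplexBridge.unity_root_in_subfield F m).
    + apply (ssrbool.introT ssrnat.ltP), Hm.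
    + exact HF.
    + exact Hz.
    + rewrite Hc, Nat.mul_comm, Cpow_mult_r, char_unity by exact H. apply Cpow_1_l.
  - apply char_0 in H. rewrite H. exact (subfield_0 F HF).
Qed.

Variable s : nat.
Hypothesis Hs : (2 <= s)%nat.

Lemma Rabs_Re_char n : (Rabs (Re (chi n)) <= 1)%R.
Proof. eapply Rle_trans; [apply re_le_Cmod|apply char_Cmod]. Qed.

Lemma Rabs_Im_char n : (Rabs (Im (chi n)) <= 1)%R.
Proof.
  eapply Rle_trans; [|apply (char_Cmod n)].
  eapply Rle_trans; [apply Rmax_r|apply Rmax_Cmod].
Qed.

Lemma Series_periodic (a : nat -> R) : (forall n, (Rabs (a n) <= 1)%R) ->
  (forall m r, a (m * q + r)%nat = a r) ->
  Series (fun n => / INR (S n) ^ s * a n)%R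
  = Rsum (fun r => / INR q ^ s * hur s (INR (S r) / INR q) * a r)%R q.
Proof.
  intros Ha Hp. apply Series_blocks; [lia|apply ex_series_bounded_mult; [exact Hs|exact Ha]|].
  intros r _.
  apply is_series_ext with (fun m => a r * / (INR (m * q + r) + 1) ^ s)%R.
  - intros m. rewrite Hp, S_INR. apply Rmult_comm.
  - replace (/ INR q ^ s * hur s (INR (S r) / INR q) * a r)%R
      with (a r * (/ INR q ^ s * hur s ((1 + INR r) / INR q)))%R
      by (rewrite S_INR, (Rplus_comm 1); ring).
    apply (is_series_scal (V := R_NormedModule) (a r)
      (fun m => / (INR (m * q + r) + 1) ^ s)%R).
    apply is_series_hur_block; [exact Hs|lia|lra].
Qed.

Lemma Lval_hur : Lval s chi
  = Csum (fun a => RtoC (/ INR q ^ s * hur s (INR a / INR q)) * chi (Z.of_nat a)) q.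
Proof.
  set (f := fun a => RtoC (/ INR q ^ s * hur s (INR a / INR q)) * chi (Z.of_nat a)).
  (* The series runs through residues $1,\dots,q$ and the sum through $0,\dots,q-1$. They agree as
     [chi] vanishes at both ends, which also disposes of the default value [hur s 0]. *)
  assert (E : Csum f q = Csum (fun r => f (S r)) q).
  { assert (E := Csum_first f q). simpl in E.
    replace (f q) with (RtoC 0) in E by (unfold f; rewrite char_at_q; ring).
    replace (f O) with (RtoC 0) in E by (unfold f; rewrite char_at_0; ring).
    rewrite Cplus_0_r, Cplus_0_l in E. exact E. }
  rewrite E. unfold Lval, Cseries.
  assert (Hp : forall m r, chi (Z.of_nat (S (m * q + r))) = chi (Z.of_nat (S r))).
  { intros m r. rewrite <- (char_period (Z.of_nat (S r)) (Z.of_nat m)). f_equal. lia. }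
  apply injective_projections; cbn [fst snd].
  - change (fst (Csum (fun r => f (S r)) q)) with (Re (Csum (fun r => f (S r)) q)).
    rewrite Re_Csum.
    rewrite (Series_ext _ (fun n => / INR (S n) ^ s * Re (chi (Z.of_nat (S n))))%R)
      by (intros n; rewrite Lval_term, Re_real_mult; reflexivity).
    rewrite (Series_periodic (fun n => Re (chi (Z.of_nat (S n))))).
    + apply Rsum_ext. intros r _. unfold f. rewrite Re_real_mult. reflexivity.
    + intros; apply Rabs_Re_char.
    + intros; rewrite Hp; reflexivity.
  - change (snd (Csum (fun r => f (S r)) q)) with (Im (Csum (fun r => f (S r)) q)).
    rewrite Im_Csum.
    rewrite (Series_ext _ (fun n => / INR (S n) ^ s * Im (chi (Z.of_nat (S n))))%R)
      by (intros n; rewrite Lval_term, Im_real_mult; reflexivity).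
    rewrite (Series_periodic (fun n => Im (chi (Z.of_nat (S n))))).
    + apply Rsum_ext. intros r _. unfold f. rewrite Im_real_mult. reflexivity.
    + intros; apply Rabs_Im_char.
    + intros; rewrite Hp; reflexivity.
Qed.

Hypothesis Heven : chi (-1)%Z = 1.

Lemma char_even n : chi (- n)%Z = chi n.
Proof.
  replace (- n)%Z with (-1 * n)%Z by lia. rewrite char_mult, Heven. ring.
Qed.

(** Evenness lets the terms at $a$ and $q - a$ be averaged, which replaces [hur] by the two-sided
    [hur2] and brings in the factor 1/2. *)
Lemma Lval_hur2 : Lval s chi
  = Csum (fun a => RtoC (/ 2 * / INR q ^ s * hur2 s (INR a / INR q)) * chi (Z.of_nat a)) q.
Proof.
  set (f := fun a => RtoC (/ INR q ^ s * hur s (INR a / INR q)) * chi (Z.of_nat a)).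
  assert (E0 : f O = 0) by (unfold f; rewrite char_at_0; ring).
  assert (Eq : f q = 0) by (unfold f; rewrite char_at_q; ring).
  assert (E : Csum f q = Csum (fun a => f (q - a)%nat) q).
  { assert (E := Csum_rev f q). simpl in E.
    rewrite Nat.sub_diag, E0, Eq, !Cplus_0_r in E. symmetry. exact E. }
  assert (E2 : RtoC 2 * Lval s chi = Csum (fun a => f a + f (q - a)%nat) q).
  { rewrite Csum_plus, <- E, Lval_hur. fold f. rewrite <- (Cmult_1_l (Csum f q)) at 2 3.
    rewrite <- Cmult_plus_distr_r. f_equal. rewrite <- RtoC_plus. f_equal; lra. }
  replace (Lval s chi) with (RtoC (/ 2) * (RtoC 2 * Lval s chi)).
  2: { rewrite Cmult_assoc, <- RtoC_mult. replace (/ 2 * 2)%R with 1%R by lra. ring. }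
  rewrite E2, <- Csum_scal. apply Csum_ext. intros a Ha.
  unfold f, hur2.
  replace (chi (Z.of_nat (q - a))) with (chi (Z.of_nat a)).
  2: { rewrite <- char_even, <- (char_period _ 1). f_equal. lia. }
  replace (INR (q - a) / INR q)%R with (1 - INR a / INR q)%R.
  2: { rewrite minus_INR by lia. field. apply INR_neq0. lia. }
  rewrite <- Cmult_plus_distr_r, <- RtoC_plus, Cmult_assoc, <- RtoC_mult.
  f_equal. f_equal. ring.
Qed.

End Characters.

(** The sum is at least $1 - 1/4 - \sum_{n \ge 3} 1/(n(n-1)) = 1/4$. Applied to real parts, it
    yields the non-vanishing of the $L$-values. *)
Lemma Series_pos_of_first (a : nat -> R) : ex_series a -> a O = 1%R ->
  (forall n, (Rabs (a n) <= / INR (S n) ^ 2)%R) -> (0 < Series a)%R.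
Proof.
  intros Ea E0 Hb.
  rewrite Series_incr_1 by exact Ea.
  assert (Ea1 : ex_series (fun n => a (S n))) by exact (proj1 (ex_series_incr_1 a) Ea).
  rewrite Series_incr_1 by exact Ea1. rewrite E0.
  assert (H1 := Hb 1%nat). simpl in H1. apply Rabs_le_between in H1.
  assert (Ea2 : ex_series (fun n => a (S (S n))))
    by exact (proj1 (ex_series_incr_1 (fun n => a (S n))) Ea1).
  set (t := fun n => (/ INR (S n) - / INR (S (S n)))%R).
  assert (Et : ex_series t) by (exists 1%R; apply is_series_telescope).
  assert (St : Series t = 1%R) by (apply is_series_unique, is_series_telescope).
  assert (Et1 : ex_series (fun n => t (S n))) by exact (proj1 (ex_series_incr_1 t) Et).
  rewrite Series_incr_1 in St by exact Et. unfold t at 1 in St. simpl in St.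
  assert (B : (0 <= Series (fun n => t (S n) + a (S (S n))))%R).
  { rewrite <- Series_zero. apply Series_le.
    - intros n. split; [lra|].
      assert (H := Hb (S (S n))). apply Rabs_le_between in H.
      assert (P : (1 <= INR (S n))%R) by (rewrite S_INR; generalize (pos_INR n); lra).
      assert (Q : (/ INR (S (S (S n))) ^ 2 <= t (S n))%R).
      { unfold t. rewrite (S_INR (S (S n))). set (y := INR (S (S n))).
        assert (Hy : (1 <= y)%R) by (unfold y; rewrite S_INR; lra).
        replace (/ y - / (y + 1))%R with (/ (y * (y + 1)))%R by (field; lra).
        apply Rinv_le_contravar; nra. }
      lra.
    - apply (ex_series_plus (V := R_NormedModule) (fun n => t (S n)) (fun n => a (S (S n))));
        assumption. }
  rewrite Series_plus in B by assumption.
  lra.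
Qed.

Lemma Lval_neq0 q chi s : (2 < q)%nat -> is_dirichlet_char q chi -> (2 <= s)%nat ->
  Lval s chi <> 0.
Proof.
  intros Hq Hchi Hs E. apply (f_equal fst) in E. unfold Lval, Cseries in E.
  cbn [fst RtoC] in E.
  rewrite (Series_ext _ (fun n => / INR (S n) ^ s * Re (chi (Z.of_nat (S n))))%R) in E.
  2: { intros n. rewrite (Lval_term chi s), Re_real_mult; reflexivity. }
  apply Rgt_not_eq in E; [contradiction|].
  apply Series_pos_of_first.
  - apply (ex_series_bounded_mult s (fun n => Re (chi (Z.of_nat (S n)))) Hs).
    intros; apply (Rabs_Re_char q chi Hq Hchi).
  - change (Z.of_nat 1) with 1%Z. rewrite (char_1 q chi Hchi).
    simpl INR. rewrite pow1. unfold Re; simpl. field.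
  - intros n. assert (P : (1 <= INR (S n))%R) by (rewrite S_INR; generalize (pos_INR n); lra).
    assert (P' : (0 < / INR (S n) ^ s)%R) by (apply Rinv_0_lt_compat, pow_lt; lra).
    rewrite Rabs_mult, (Rabs_right (/ _)) by lra.
    assert (H := Rabs_Re_char q chi Hq Hchi (Z.of_nat (S n))).
    assert (I1 := pow_inv_le (INR (S n)) s P Hs). nra.
Qed.

Lemma zeta_at_hur s : zeta_at s = RtoC (hur s 1).
Proof.
  unfold zeta_at, Cseries, hur.
  assert (E : forall n, / RtoC (INR (S n) ^ s) = RtoC (/ (INR n + 1) ^ s)).
  { intros n. rewrite <- S_INR, RtoC_inv; [reflexivity|].
    apply pow_nonzero, not_0_INR. lia. }
  apply injective_projections; cbn [fst snd RtoC].
  - apply Series_ext. intros n. rewrite E. reflexivity.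
  - rewrite (Series_ext _ (fun _ => 0%R)) by (intros n; rewrite E; reflexivity).
    apply Series_zero.
Qed.

Lemma zeta_at_neq0 s : (2 <= s)%nat -> zeta_at s <> 0.
Proof.
  intros Hs E. rewrite zeta_at_hur in E. apply RtoC_inj in E.
  rewrite (hur_step s Hs 1) in E by lra.
  assert (H := hur_pos s Hs (1 + 1) ltac:(lra)).
  rewrite pow1, Rinv_1 in E. lra.
Qed.

(** At $x = 1/2$ the squared cosecant is 1 and [hur2] is $2\zeta(s,1/2) = 2(2^s - 1)\zeta(s)$, by
    [hur_double] at 1. *)
Lemma zeta_at_rat j : exists r, ratR r /\
  zeta_at (2 * S j) = RtoC (PI ^ (2 * S j) * r).
Proof.
  set (s := (2 * S j)%nat). assert (Hs : (2 <= s)%nat) by (unfold s; lia).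
  destruct (hur2_ratpoly j) as (P & HP & E). fold s in E.
  specialize (E (1 / 2)%R ltac:(lra)).
  assert (H2 : (2 < 2 ^ s)%R).
  { apply Rlt_le_trans with (2 ^ 2)%R; [simpl; lra|apply Rle_pow; [lra|exact Hs]]. }
  exists (/ (2 * (2 ^ s + -1)) * P 1)%R. split.
  - apply ratR_mult; [|apply (ratpoly_rat _ _ _ HP), ratR_IZR].
    apply ratR_inv, ratR_mult; [apply ratR_IZR|].
    apply ratR_plus; [apply ratR_pow|]; apply ratR_IZR.
  - rewrite zeta_at_hur. f_equal.
    assert (D := hur_double s Hs 1 ltac:(lra)).
    replace ((1 + 1) / 2)%R with 1%R in D by field.
    unfold hur2 in E. replace (1 - 1 / 2)%R with (1 / 2)%R in E by field.
    replace (csc2 (1 / 2)) with 1%R in E.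
    2: { unfold csc2. replace (PI * (1 / 2))%R with (PI / 2)%R by field.
         rewrite sin_PI2. field. }
    apply Rmult_eq_reg_l with (2 * (2 ^ s + -1))%R; [|lra].
    replace (2 * (2 ^ s + -1) * (PI ^ s * (/ (2 * (2 ^ s + -1)) * P 1)))%R
      with (PI ^ s * P 1)%R by (field; lra).
    rewrite <- E. lra.
Qed.

(** * Linear independence *)

Lemma csc2_period q n : (0 < q)%nat ->
  csc2 (INR (n mod q) / INR q) = csc2 (INR n / INR q).
Proof.
  intros Hq. rewrite !csc2_theta. rewrite (Nat.div_mod_eq n q) at 2.
  rewrite Nat.add_comm, Nat.mul_comm, theta_period by exact Hq. reflexivity.
Qed.

(** The polynomial represents $b \mapsto \sum_a c\,P(1/\sin^2(\pi ab/q))\chi(a)$. Multiplied by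
    $\chi(b)$, the sum depends on $ab$ only, so reindexing brings back its value at $b = 1$. *)
Lemma Lval_conjugates F N q M chi j :
  is_subfield F -> (2 < q)%nat -> (0 < M)%nat -> N = (q * M)%nat ->
  is_dirichlet_char q chi -> chi (-1)%Z = 1 -> (forall n, F (chi n)) ->
  exists p, List.Forall F p /\ forall b, Nat.gcd b N = 1%nat ->
    RtoC (PI ^ (2 * S j)) * Ceval p (RtoC (theta N b)) * chi (Z.of_nat b)
    = Lval (2 * S j) chi.
Proof.
  intros HF Hq HM HN Hchi Heven Fchi.
  assert (HN0 : (0 < N)%nat) by nia.
  set (s := (2 * S j)%nat). assert (Hs : (2 <= s)%nat) by (unfold s; lia).
  destruct (hur2_ratpoly j) as (P & HP & EP). fold s in EP.
  set (c := (/ 2 * / INR q ^ s)%R).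
  assert (Hc : F (RtoC c)).
  { apply (subfield_rat F HF), ratR_is_rat. unfold c.
    apply ratR_mult; apply ratR_inv; [apply ratR_IZR|apply ratR_pow, ratR_INR]. }
  set (G := fun n => RtoC (c * P (csc2 (INR n / INR q))) * chi (Z.of_nat n)).
  assert (Rg : representable F N (fun b =>
    Csum (fun a => RtoC (c * P (csc2 (INR (a * b) / INR q))) * chi (Z.of_nat a)) q)).
  { apply (representable_sum F N HF (fun a b =>
      RtoC (c * P (csc2 (INR (a * b) / INR q))) * chi (Z.of_nat a))).
    (* The pole at [a = 0] falls outside [representable_csc2], but its term carries the factor
       [chi 0 = 0]. *)
    intros a Ha. destruct (Nat.eq_dec a 0) as [->|Ha0].
    - apply (representable_ext F N (fun _ => 0)).
      + apply representable_const, (subfield_0 F HF).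
      + intros b _. rewrite (char_at_0 q chi Hq Hchi). ring.
    (* Writing $a/q = aM/N$ raises every modulus to the common level $N$. *)
    - apply (representable_ext F N (fun b =>
        RtoC c * RtoC (P (csc2 (INR ((a * M) * b) / INR N))) * chi (Z.of_nat a))).
      + apply representable_mult; [exact HF| |apply representable_const, Fchi].
        apply representable_mult; [exact HF|apply representable_const, Hc|].
        apply (representable_ratpoly F N HF (S j) P
          (fun b => csc2 (INR ((a * M) * b) / INR N)) HP).
        apply representable_csc2; [exact HF|exact HN0|].
        rewrite Nat.mod_small by nia. nia.
      + intros b _. rewrite RtoC_mult. do 5 f_equal.
        rewrite HN, !mult_INR. field.
        split; apply INR_neq0; lia. }
  destruct Rg as [p [Hp Ep]]. exists p. split; [exact Hp|].
  intros b Hb. rewrite Ep by exact Hb.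
  assert (Hbq : Nat.gcd b q = 1%nat).
  { apply Nat.divide_1_r. rewrite <- Hb. apply Nat.gcd_greatest.
    - apply Nat.gcd_divide_l.
    - rewrite HN. apply Nat.divide_mul_l, Nat.gcd_divide_r. }
  assert (E1 : Csum (fun a => RtoC (c * P (csc2 (INR (a * b) / INR q))) * chi (Z.of_nat a)) q
    * chi (Z.of_nat b) = Csum G q).
  { rewrite <- (Arithmetic.Csum_mul_perm G q b).
    - rewrite Cmult_comm, <- Csum_scal. apply Csum_ext. intros a _. unfold G.
      change (ssrnat.muln a b) with (a * b)%nat.
      rewrite Nat2Z.inj_mul, (char_mult q chi Hchi). ring.
    - apply (ssrbool.introT ssrnat.ltP). lia.
    - intros n. rewrite <- Arithmetic.modE. unfold G.
      rewrite csc2_period, (char_mod_nat q chi Hq Hchi) by lia. reflexivity.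
    - exact Hbq. }
  rewrite <- Cmult_assoc, E1, <- Csum_scal.
  rewrite (Lval_hur2 q chi Hq Hchi s Hs Heven).
  apply Csum_ext. intros a Ha. unfold G.
  destruct (Nat.eq_dec a 0) as [->|Ha0].
  { rewrite (char_at_0 q chi Hq Hchi). ring. }
  rewrite EP.
  - rewrite Cmult_assoc, <- RtoC_mult. do 2 f_equal. unfold c. ring.
  - assert (0 < INR a)%R by (apply lt_0_INR; lia).
    assert (INR a < INR q)%R by (apply lt_INR; lia).
    split; [apply Rdiv_lt_0_compat; lra|].
    apply Rmult_lt_reg_r with (INR q); [lra|].
    unfold Rdiv. rewrite Rmult_assoc, Rinv_l by lra. lra.
Qed.

Definition lincomb (l : list (C * C)) : C :=
  fold_right Cplus 0 (map (fun p : C * C => Cmult (fst p) (snd p)) l).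

(* Dedekind's argument: elements of [S] with pairwise different systems of
   eigenvalues [psi z b] are independent. *)
Lemma eigen_independent (F S : C -> Prop) (B : nat -> Prop) (psi : C -> nat -> C) :
  is_subfield F ->
  (forall z b, S z -> B b -> F (psi z b)) ->
  (forall z, S z -> z <> 0) ->
  (forall z z', S z -> S z' -> z <> z' -> exists b, B b /\ psi z b <> psi z' b) ->
  (forall l, List.Forall (fun p : C * C => F (fst p) /\ S (snd p)) l ->
     lincomb l = 0 -> forall b, B b ->
     lincomb (map (fun p => (fst p * psi (snd p) b, snd p)) l) = 0) ->
  lin_indep_over F S.
Proof.
  intros HF Fpsi Snz Sdist Htr l.
  remember (length l) as n eqn:Hn. revert l Hn.
  induction n as [|n IH]; intros [|[c0 z0] l] Hn Hnd HFS Hl; try discriminate;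
    [constructor|].
  inversion Hnd as [|x y Hz0 Hnd']; subst. inversion HFS as [|x y [Fc0 Sz0] HFS']; subst.
  simpl in Fc0, Sz0. injection Hn as Hn.
  assert (Htail : forall c z, In (c, z) l -> c = 0).
  { intros c z Hin.
    assert (HFSz := HFS'). rewrite List.Forall_forall in HFSz.
    destruct (HFSz _ Hin) as [Fc Sz]; simpl in Fc, Sz.
    assert (Hne : z <> z0).
    { intros ->. apply Hz0. apply (in_map snd) in Hin. exact Hin. }
    destruct (Sdist z z0 Sz Sz0 Hne) as [b [Hb Hpsi]].
    assert (Hlb := Htr _ HFS Hl b Hb).
    (* Transported relation minus [psi z0 b] times the original: the head term cancels and the tail
       is shorter by one. Since [b] separates [z] from [z0], vanishing of the new coefficient at [z]
       forces [c = 0]. *)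
    set (l' := map (fun p => (fst p * (psi (snd p) b - psi z0 b), snd p)) l).
    assert (El' : lincomb l' = 0).
    { assert (D : forall m : list (C * C),
        lincomb (map (fun p => (fst p * (psi (snd p) b - psi z0 b), snd p)) m)
        = lincomb (map (fun p => (fst p * psi (snd p) b, snd p)) m) - psi z0 b * lincomb m).
      { induction m as [|[c1 z1] m IHm]; unfold lincomb in *; simpl; [ring|].
        rewrite IHm. ring. }
      unfold l'. rewrite D.
      unfold lincomb in Hlb, Hl |- *. simpl in Hlb, Hl.
      set (X := fold_right Cplus 0 (map _ (map _ l))) in Hlb |- *.
      set (Y := fold_right Cplus 0 (map _ l)) in Hl |- *.
      replace (X - psi z0 b * Y) with ((c0 * psi z0 b * z0 + X) - psi z0 b * (c0 * z0 + Y))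
        by ring.
      rewrite Hlb, Hl. ring. }
    assert (Hall : List.Forall (fun p : C * C => fst p = RtoC 0) l').
    { apply (IH l').
      - unfold l'. rewrite length_map. exact Hn.
      - unfold l'. rewrite map_map. simpl. exact Hnd'.
      - unfold l'. apply List.Forall_map. eapply List.Forall_impl; [|exact HFS'].
        intros [c1 z1] [F1 S1]; simpl in *. split; [|exact S1].
        apply (subfield_mult F HF); [exact F1|].
        apply (subfield_minus F HF); apply Fpsi; assumption.
      - exact El'. }
    rewrite List.Forall_forall in Hall.
    specialize (Hall (c * (psi z b - psi z0 b), z)).
    simpl in Hall.
    assert (E : c * (psi z b - psi z0 b) = 0).
    { apply Hall. unfold l'.
      apply (in_map (fun p => (fst p * (psi (snd p) b - psi z0 b), snd p)) _ _ Hin). }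
    destruct (classic (c = 0)) as [|Hc]; [assumption|exfalso].
    apply Hpsi. apply (Cmult_neq_0 c (psi z b - psi z0 b)) in Hc; [contradiction|].
    intros E'. apply Hpsi. rewrite <- (Cplus_0_l (psi z0 b)), <- E'. ring. }
  constructor.
  - simpl.
    assert (Z : lincomb l = 0).
    { clear - Htail. induction l as [|[c z] l IH]; [reflexivity|].
      unfold lincomb in *. simpl. rewrite IH by (intros c1 z1 H; apply (Htail c1 z1); right; exact H).
      rewrite (Htail c z) by (left; reflexivity). ring. }
    unfold lincomb in Z. simpl in Hl. rewrite Z, Cplus_0_r in Hl.
    destruct (classic (c0 = 0)) as [|Hc]; [assumption|exfalso].
    apply (Cmult_neq_0 c0 z0 Hc (Snz z0 Sz0)). exact Hl.
  - apply List.Forall_forall. intros [c z] Hin. exact (Htail c z Hin).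
Qed.

(** * Coprime moduli and the separation of characters by units *)

Lemma nprod_divide l f i : (i < l)%nat -> Nat.divide (f i) (nprod l f).
Proof.
  intros Hi. unfold nprod.
  assert (Hin : In i (seq 0 l)) by (apply in_seq; lia).
  induction (seq 0 l) as [|a L IH]; [destruct Hin|].
  simpl. destruct Hin as [->|Hin].
  - apply Nat.divide_factor_l.
  - apply Nat.divide_mul_r, IH, Hin.
Qed.

Lemma nprod_pos l f : (forall i, (i < l)%nat -> (0 < f i)%nat) -> (0 < nprod l f)%nat.
Proof.
  intros H. unfold nprod.
  assert (H' : forall i, In i (seq 0 l) -> (0 < f i)%nat)
    by (intros i Hi; apply in_seq in Hi; apply H; lia).
  induction (seq 0 l) as [|a L IH]; simpl; [lia|].
  assert (0 < f a)%nat by (apply H'; left; reflexivity).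
  assert (0 < fold_right Nat.mul 1%nat (map f L))%nat
    by (apply IH; intros; apply H'; right; assumption).
  nia.
Qed.

Lemma nprod_split l f i : (i < l)%nat ->
  (forall i j, (i < l)%nat -> (j < l)%nat -> i <> j -> Nat.gcd (f i) (f j) = 1%nat) ->
  exists M, nprod l f = (f i * M)%nat /\ Nat.gcd (f i) M = 1%nat /\
    forall j, (j < l)%nat -> j <> i -> Nat.divide (f j) M.
Proof.
  intros Hi Hco.
  assert (Hin : In i (seq 0 l)) by (apply in_seq; lia).
  destruct (in_split _ _ Hin) as (L1 & L2 & E).
  assert (Hnd := seq_NoDup l 0). rewrite E in Hnd. apply NoDup_remove_2 in Hnd.
  set (L := L1 ++ L2) in Hnd.
  assert (HL : forall j, In j L -> (j < l)%nat /\ j <> i).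
  { intros j Hj. split; [|intros ->; contradiction].
    assert (Hj' : In j (seq 0 l)).
    { rewrite E. apply in_or_app. apply in_app_or in Hj. simpl. tauto. }
    apply in_seq in Hj'. lia. }
  exists (fold_right Nat.mul 1%nat (map f L)). split; [|split].
  - unfold nprod. rewrite E. unfold L. clear. induction L1 as [|a L1 IH]; simpl; [reflexivity|].
    rewrite IH. lia.
  - clear Hnd E. induction L as [|a L IH]; simpl; [apply Nat.divide_1_r, Nat.gcd_divide_r|].
    apply Nat.divide_1_r.
    set (g := Nat.gcd (f i) (f a * fold_right Nat.mul 1%nat (map f L))).
    rewrite <- IH by (intros j Hj; apply HL; right; exact Hj).
    apply Nat.gcd_greatest; [apply Nat.gcd_divide_l|].
    apply Nat.gauss with (f a); [apply Nat.gcd_divide_r|].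
    apply Nat.divide_1_r.
    destruct (HL a) as [Ha Hne]; [left; reflexivity|].
    rewrite <- (Hco i a Hi Ha (not_eq_sym Hne)).
    apply Nat.gcd_greatest; [|apply Nat.gcd_divide_r].
    eapply Nat.divide_trans; [apply Nat.gcd_divide_l|apply Nat.gcd_divide_l].
  - intros j Hj Hne.
    assert (Hj' : In j L).
    { assert (Hj' : In j (seq 0 l)) by (apply in_seq; lia).
      rewrite E in Hj'. unfold L. apply in_or_app. apply in_app_or in Hj'.
      simpl in Hj'. destruct Hj' as [H|[H|H]]; [left|congruence|right]; assumption. }
    clear - Hj'. induction L as [|a L IH]; [destruct Hj'|]. simpl.
    destruct Hj' as [->|H]; [apply Nat.divide_factor_l|].
    apply Nat.divide_mul_r, IH, H.
Qed.

Lemma crt_lift (q M : nat) (n : Z) : (0 < q)%nat -> (0 < M)%nat ->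
  Nat.gcd q M = 1%nat -> Z.gcd n (Z.of_nat q) = 1%Z ->
  exists (b : nat) (u v : Z), Nat.gcd b (q * M) = 1%nat /\
    Z.of_nat b = (n + u * Z.of_nat q)%Z /\ Z.of_nat b = (1 + v * Z.of_nat M)%Z.
Proof.
  intros Hq HM Hco Hn.
  set (Q := Z.of_nat q) in *. set (W := Z.of_nat M).
  assert (Hg : Z.gcd Q W = 1%Z) by (unfold Q, W; rewrite Zgcd_of_nat, Hco; reflexivity).
  destruct (Z.gcd_bezout _ _ _ Hg) as (x & y & Hxy).
  (* From $xQ + yW = 1$: [b0] is $n$ modulo $Q$ and $1$ modulo $W$. It is then reduced modulo $QW$
     to give a natural number, as [theta] requires. *)
  set (b0 := (n * y * W + x * Q)%Z).
  assert (HQW : (0 < Q * W)%Z) by (unfold Q, W; nia).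
  assert (Hb := Z.mod_pos_bound b0 (Q * W) HQW).
  assert (Hd := Z.div_mod b0 (Q * W) ltac:(lia)).
  set (t := (b0 / (Q * W))%Z) in *.
  exists (Z.to_nat (b0 mod (Q * W))), (x - n * x - t * W)%Z, (n * y - y - t * Q)%Z.
  rewrite Z2Nat.id by lia.
  assert (E1 : (b0 mod (Q * W) = n + (x - n * x - t * W) * Q)%Z).
  { replace (b0 mod (Q * W))%Z with (b0 - Q * W * t)%Z by lia.
    unfold b0. replace (n * y * W)%Z with (n * (x * Q + y * W) - n * x * Q)%Z by ring.
    rewrite Hxy. ring. }
  assert (E2 : (b0 mod (Q * W) = 1 + (n * y - y - t * Q) * W)%Z).
  { replace (b0 mod (Q * W))%Z with (b0 - Q * W * t)%Z by lia.
    unfold b0. replace (x * Q)%Z with ((x * Q + y * W) - y * W)%Z by ring.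
    rewrite Hxy. ring. }
  split; [|split; assumption].
  apply Nat2Z.inj. rewrite <- Zgcd_of_nat, Z2Nat.id, Nat2Z.inj_mul by lia. fold Q W.
  change (Z.of_nat 1) with 1%Z. apply Zgcd_1_rel_prime. apply rel_prime_mult.
  - apply Zgcd_1_rel_prime. rewrite E1.
    rewrite Z.gcd_comm, Z.add_comm, Z.mul_comm.
    rewrite <- Hn, (Z.gcd_comm n), Z.add_comm, Z.mul_comm. apply Z.gcd_add_mult_diag_r.
  - apply Zgcd_1_rel_prime. rewrite E2.
    rewrite Z.gcd_comm, Z.gcd_add_mult_diag_r. apply Z.gcd_1_r.
Qed.

(** The scalars of the relation lie in $F$ and enter as polynomial coefficients, so conjugation
    fixes them and only the eigenvalues appear. *)
Lemma lincomb_conjugates F S N (w : C) (psi : C -> nat -> C) : is_subfield F ->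
  (forall z, S z -> exists p, List.Forall F p /\ forall b, Nat.gcd b N = 1%nat ->
     w * Ceval p (RtoC (theta N b)) = psi z b * z) ->
  forall l, List.Forall (fun p : C * C => F (fst p) /\ S (snd p)) l ->
  exists p, List.Forall F p /\ forall b, Nat.gcd b N = 1%nat ->
    w * Ceval p (RtoC (theta N b))
    = lincomb (map (fun p => (fst p * psi (snd p) b, snd p)) l).
Proof.
  intros HF HS l Hl; induction Hl as [|[c z] l [Fc Sz] Hl [p [Hp Ep]]].
  - exists []. split; [constructor|]. intros b _. unfold Ceval, lincomb; simpl. ring.
  - simpl in Fc, Sz. destruct (HS z Sz) as [r [Hr Er]].
    exists (Cpadd (Cpscal c r) p). split.
    + apply Forall_padd; [exact HF|apply Forall_pscal|]; assumption.
    + intros b Hb. rewrite Ceval_add, Ceval_scal.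
      replace (w * (c * Ceval r (RtoC (theta N b)) + Ceval p (RtoC (theta N b))))
        with (c * (w * Ceval r (RtoC (theta N b))) + w * Ceval p (RtoC (theta N b))) by ring.
      rewrite Er, Ep by exact Hb. unfold lincomb; simpl. ring.
Qed.

(** Both functions vanish off the units, so they can differ only at a unit. Asking just this of
    [chi'] lets [principal_char] be used directly. *)
Lemma char_neq_witness q (chi chi' : Z -> C) :
  is_dirichlet_char q chi ->
  (forall n, Z.gcd n (Z.of_nat q) <> 1%Z -> chi' n = 0) -> chi <> chi' ->
  exists n, Z.gcd n (Z.of_nat q) = 1%Z /\ chi n <> chi' n.
Proof.
  intros Hchi Hchi' Hne.
  apply NNPP. intros H. apply Hne. apply functional_extensionality. intros n.
  destruct (Z.eq_dec (Z.gcd n (Z.of_nat q)) 1) as [E|E].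
  - apply NNPP. intros H'. apply H. exists n. split; assumption.
  - rewrite (Hchi' n E). apply (char_0 q chi Hchi), E.
Qed.

Section Separation.
Variables (l : nat) (q : nat -> nat).
Hypothesis Hq : forall i, (i < l)%nat -> (2 < q i)%nat.
Hypothesis Hco : forall i j, (i < l)%nat -> (j < l)%nat -> i <> j ->
  Nat.gcd (q i) (q j) = 1%nat.

(** The Chinese remainder unit that is [n] modulo [q i] and 1 modulo the other moduli: it tests one
    modulus while all characters of the others stay trivial. *)
Lemma lift_unit i n : (i < l)%nat -> Z.gcd n (Z.of_nat (q i)) = 1%Z ->
  exists b, Nat.gcd b (nprod l q) = 1%nat /\
   (forall chi, is_dirichlet_char (q i) chi -> chi (Z.of_nat b) = chi n) /\
   (forall j chi, (j < l)%nat -> j <> i -> is_dirichlet_char (q j) chi ->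
      chi (Z.of_nat b) = 1).
Proof.
  intros Hi Hn.
  destruct (nprod_split l q i Hi Hco) as (M & EM & Hg & Hd).
  assert (HP : (0 < nprod l q)%nat)
    by (apply nprod_pos; intros j Hj; specialize (Hq j Hj); lia).
  assert (Hqi := Hq i Hi).
  destruct (crt_lift (q i) M n) as (b & u & v & Hb & E1 & E2); [lia|nia|assumption..|].
  exists b. rewrite EM. split; [exact Hb|split].
  - intros chi Hchi. rewrite E1. apply (char_period (q i) chi Hchi).
  - intros j chi Hj Hne Hchi. destruct (Hd j Hj Hne) as [c Hc].
    rewrite E2, Hc, Nat2Z.inj_mul, Z.mul_assoc, (char_period (q j) chi Hchi).
    apply (char_1 (q j) chi Hchi).
Qed.

Lemma nonprincipal_lift i chi : (i < l)%nat -> is_dirichlet_char (q i) chi ->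
  chi <> principal_char (q i) ->
  exists b, Nat.gcd b (nprod l q) = 1%nat /\ chi (Z.of_nat b) <> 1 /\
   (forall j chi', (j < l)%nat -> j <> i -> is_dirichlet_char (q j) chi' ->
      chi' (Z.of_nat b) = 1).
Proof.
  intros Hi Hchi Hne.
  destruct (char_neq_witness (q i) chi (principal_char (q i))) as (n & Hn & Hv);
    [assumption| |assumption|].
  { intros n Hn. unfold principal_char. apply Z.eqb_neq in Hn. rewrite Hn. reflexivity. }
  unfold principal_char in Hv. rewrite Hn in Hv. simpl in Hv.
  destruct (lift_unit i n Hi Hn) as (b & Hb & H1 & H2).
  exists b. split; [exact Hb|split; [|exact H2]]. rewrite H1 by exact Hchi. exact Hv.
Qed.

(** For equal moduli a unit where the characters differ is lifted. For different moduli a lift that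
    is nontrivial for [chi] is trivial for [chi']. *)
Lemma chars_separated i j chi chi' : (i < l)%nat -> (j < l)%nat ->
  is_dirichlet_char (q i) chi -> is_dirichlet_char (q j) chi' ->
  chi <> principal_char (q i) -> chi <> chi' ->
  exists b, Nat.gcd b (nprod l q) = 1%nat /\ chi (Z.of_nat b) <> chi' (Z.of_nat b).
Proof.
  intros Hi Hj Hchi Hchi' Hnp Hne.
  destruct (Nat.eq_dec j i) as [->|Hji].
  - destruct (char_neq_witness (q i) chi chi') as (n & Hn & Hv);
      [assumption| |assumption|].
    { intros n Hn. apply (char_0 (q i) chi' Hchi'), Hn. }
    destruct (lift_unit i n Hi Hn) as (b & Hb & H1 & _).
    exists b. split; [exact Hb|]. rewrite !H1 by assumption. exact Hv.
  - destruct (nonprincipal_lift i chi Hi Hchi Hnp) as (b & Hb & H1 & H2).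
    exists b. split; [exact Hb|]. rewrite (H2 j chi' Hj Hji Hchi'). exact H1.
Qed.

Lemma char_unit_neq0 i chi b : (i < l)%nat -> is_dirichlet_char (q i) chi ->
  Nat.gcd b (nprod l q) = 1%nat -> chi (Z.of_nat b) <> 0.
Proof.
  intros Hi Hchi Hb E. apply (char_0 (q i) chi Hchi) in E. apply E.
  rewrite Zgcd_of_nat. f_equal. change 1%Z with (Z.of_nat 1). f_equal.
  apply Nat.divide_1_r. rewrite <- Hb. apply Nat.gcd_greatest.
  - apply Nat.gcd_divide_l.
  - eapply Nat.divide_trans; [apply Nat.gcd_divide_r|apply nprod_divide, Hi].
Qed.

End Separation.

Lemma Cinv_inj_neq x y : x <> y -> / x <> / y.
Proof.
  intros H E. apply H.
  assert (D : forall z, / / z = z).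
  { intros z. destruct (classic (z = 0)) as [->|Hz]; [rewrite !Cinv_0; reflexivity|].
    field. exact Hz. }
  rewrite <- (D x), <- (D y), E. reflexivity.
Qed.

Theorem theorem1p4 (l : nat) (q : nat -> nat) (k : nat) (K : C -> Prop) :
  (1 <= l)%nat ->
  (forall i, (i < l)%nat -> (2 < q i)%nat) ->
  (forall i j, (i < l)%nat -> (j < l)%nat -> i <> j -> Nat.gcd (q i) (q j) = 1%nat) ->
  (1 <= k)%nat ->
  is_number_field K ->
  (forall z, (adjoin K (zeta_root (nprod l (fun i => totient (q i)))) z /\
              cyclo_plus (nprod l q) z) <-> is_rat_C z) ->
  lin_indep_over (adjoin K (zeta_root (nprod l (fun i => totient (q i)))))
    (fun z => z = zeta_at (2 * k) \/
              exists i, (i < l)%nat /\ X_even (q i) (2 * k) z).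
Proof.
  intros _ Hq Hco Hk _ Hint.
  destruct k as [|j]; [lia|]. clear Hk.
  set (s := (2 * S j)%nat). assert (Hs : (2 <= s)%nat) by (unfold s; lia).
  set (m := nprod l (fun i => totient (q i))) in *.
  set (N := nprod l q) in *.
  set (F := adjoin K (zeta_root m)) in *.
  assert (HF : is_subfield F) by apply adjoin_subfield.
  assert (HN : (0 < N)%nat) by (apply nprod_pos; intros i Hi; specialize (Hq i Hi); lia).
  assert (Hm : (0 < m)%nat)
    by (apply nprod_pos; intros i Hi; apply totient_pos, Hq, Hi).
  assert (Hpi : RtoC (PI ^ s) <> 0).
  { intros E. apply RtoC_inj in E. revert E. apply pow_nonzero. generalize PI_RGT_0; lra. }
  assert (Fchi : forall i chi n, (i < l)%nat -> is_dirichlet_char (q i) chi -> F (chi n)).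
  { intros i chi n Hi Hchi.
    apply (char_in_subfield (q i) chi (Hq i Hi) Hchi F m n HF Hm).
    - apply (nprod_divide l (fun i => totient (q i)) i Hi).
    - apply adjoin_gen. }
  (* The set consists of values rather than characters, so [psi] chooses for each value one
     eigensystem producing it. Distinct values then automatically come from distinct data. *)
  set (Q := fun (z : C) (psi : nat -> C) =>
    (z = zeta_at s /\ psi = (fun _ => 1)) \/
    exists i chi, (i < l)%nat /\ is_dirichlet_char (q i) chi /\ chi (-1)%Z = 1 /\
      chi <> principal_char (q i) /\ z = Lval s chi /\
      psi = (fun b => / chi (Z.of_nat b))).
  set (S := fun z => z = zeta_at s \/ exists i, (i < l)%nat /\ X_even (q i) s z).
  assert (HQ : forall z, exists psi, S z -> Q z psi).
  { intros z. destruct (classic (S z)) as [[Hz|(i & Hi & chi & H1 & H2 & H3 & H4)]|Hn].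
    - exists (fun _ => 1). intros _. left. split; [exact Hz|reflexivity].
    - exists (fun b => / chi (Z.of_nat b)). intros _. right. exists i, chi. tauto.
    - exists (fun _ => 1). contradiction. }
  set (psi := fun z => proj1_sig (constructive_indefinite_description _ (HQ z))).
  assert (Hpsi : forall z, S z -> Q z (psi z)).
  { intros z. apply (proj2_sig (constructive_indefinite_description _ (HQ z))). }
  clearbody psi.
  assert (Hconj : forall z, S z -> exists p, List.Forall F p /\
    forall b, Nat.gcd b N = 1%nat ->
      RtoC (PI ^ s) * Ceval p (RtoC (theta N b)) = psi z b * z).
  { intros z Sz. destruct (Hpsi z Sz) as [[-> ->]|(i & chi & Hi & Hchi & He & Hne & -> & ->)].
    - destruct (zeta_at_rat j) as (r & Hr & E). exists [RtoC r]. split.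
      + repeat constructor. apply (subfield_rat F HF), ratR_is_rat, Hr.
      + intros b _. rewrite Ceval_const. fold s in E. rewrite E, RtoC_mult. ring.
    - destruct (nprod_split l q i Hi Hco) as (M & EM & _ & _).
      destruct (Lval_conjugates F N (q i) M chi j) as (p & Hp & E); try assumption.
      + apply Hq, Hi.
      + unfold N in HN. rewrite EM in HN. nia.
      + intros n. apply (Fchi i chi n Hi Hchi).
      + exists p. split; [exact Hp|]. intros b Hb. fold s in E. rewrite <- (E b Hb).
        assert (Hnz := char_unit_neq0 l q i chi b Hi Hchi Hb). field. exact Hnz. }
  apply (eigen_independent F S (fun b => Nat.gcd b N = 1%nat) psi HF).
  - intros z b Sz _. destruct (Hpsi z Sz) as [[_ ->]|(i & chi & Hi & Hchi & _ & _ & _ & ->)].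
    + exact (subfield_1 F HF).
    + apply (subfield_inv F HF), (Fchi i chi _ Hi Hchi).
  - intros z Sz. destruct (Hpsi z Sz) as [[-> _]|(i & chi & Hi & Hchi & _ & _ & -> & _)].
    + apply zeta_at_neq0, Hs.
    + apply (Lval_neq0 (q i)); [apply Hq, Hi|assumption..].
  (* Zeta against an $L$-value: the trivial eigensystem is separated from that of a nonprincipal
     character. *)
  - assert (One : forall z z' i chi, (i < l)%nat -> is_dirichlet_char (q i) chi ->
      chi <> principal_char (q i) -> psi z = (fun _ => 1) ->
      psi z' = (fun b => / chi (Z.of_nat b)) ->
      exists b, Nat.gcd b N = 1%nat /\ psi z b <> psi z' b).
    { intros z z' i chi Hi Hchi Hne -> ->.
      destruct (nonprincipal_lift l q Hq Hco i chi Hi Hchi Hne) as (b & Hb & H1 & _).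
      exists b. split; [exact Hb|]. intros E. apply (Cinv_inj_neq _ _ H1).
      rewrite <- E. field. }
    intros z z' Sz Sz' Hzz.
    destruct (Hpsi z Sz) as [[Ez Ep]|(i & chi & Hi & Hchi & He & Hne & Ez & Ep)];
    destruct (Hpsi z' Sz') as [[Ez' Ep']|(i' & chi' & Hi' & Hchi' & He' & Hne' & Ez' & Ep')].
    + congruence.
    + apply (One z z' i' chi'); assumption.
    + destruct (One z' z i chi) as (b & Hb & E); try assumption.
      exists b. split; [exact Hb|]. apply not_eq_sym, E.
    + destruct (chars_separated l q Hq Hco i i' chi chi') as (b & Hb & E); try assumption.
      * congruence.
      * exists b. split; [exact Hb|]. rewrite Ep, Ep'. apply Cinv_inj_neq, E.
  - intros L HL EL b Hb.
    destruct (lincomb_conjugates F S N (RtoC (PI ^ s)) psi HF Hconj L HL) as (p & Hp & E).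
    rewrite <- (E b Hb).
    assert (P1 : Ceval p (RtoC (theta N 1)) = 0).
    (* At $b = 1$ all eigenvalues are 1, so [p] at [theta N 1] is the given relation divided by
       $\pi^s$. *)
    { assert (E1 := E 1%nat (Nat.divide_1_r _ (Nat.gcd_divide_l 1 N))).
      replace (map (fun p => (fst p * psi (snd p) 1%nat, snd p)) L) with L in E1.
      - rewrite EL in E1.
        destruct (classic (Ceval p (RtoC (theta N 1)) = 0)) as [|Hz]; [assumption|].
        exfalso. exact (Cmult_neq_0 _ _ Hpi Hz E1).
      - clear - HL Hpsi Hq. induction HL as [|[c z] L [_ Sz] HL IH]; [reflexivity|].
        simpl in *. rewrite <- IH.
        assert (H1 : psi z 1%nat = 1).
        { destruct (Hpsi z Sz) as [[_ ->]|(i & chi & Hi & Hchi & _ & _ & _ & ->)];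
            [reflexivity|].
          change (Z.of_nat 1) with 1%Z. rewrite (char_1 (q i) chi Hchi). field. }
        rewrite H1, Cmult_1_r. reflexivity. }
    (* The intersection hypothesis enters here, carrying the vanishing from [theta N 1] to
       [theta N b]. *)
    rewrite (ComplexBridge.zeta_conjugate_root F N b p).
    + ring.
    + apply (ssrbool.introT ssrnat.ltP), HN.
    + exact HF.
    + intros z Fz Cz. apply (proj1 (Hint z)). split; assumption.
    + apply Arithmetic.coprime_gcd, Hb.
    + exact Hp.
    + exact P1.
Qed.
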